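(* Let $p=2$, $\nu\in(0,1]$, $q=2+\nu$, and suppose that $f$ satisfies the $(2,\nu)$-Hölder condition on $\mathcal X$ with constant $L_{2,\nu}>0$. Let $\mu,L>0$ be constants with $\mu I\preceq\nabla^2f(x)\preceq LI$ for all $x\in\mathcal X$ (they exist under these assumptions). Let $\rho\in(0,1)$ and $0<\omega<\frac{c_2\mu}{L}\rho^2(1-\rho^{q/(q-1)})$, where $c_2=1/2$. Put $$C_2=\frac{L_{2,\nu}L^{(1+\nu)/2}}{(1+\nu)\sqrt\mu}+\sqrt{\frac2\mu}\left(1+\frac{L_{2,\nu}L^{(1+\nu)/2}D^\nu}{(1+\nu)\mu^{(1+\nu)/2}}\right)^{1+\nu},\qquad K_2=\min\left\{k\ge0\ \middle|\ g_k\le\frac\mu2(2C_2)^{-2/\nu}\right\}.$$ Let $\{x_k\}$ be generated by the switched damped Newton Frank–Wolfe method with switching iteration $K=K_2$ and exponent $a=2(1+\nu)$ (with either inner procedure FW or AFW). Then $K_2$ is finite, and either the sequence reaches $x^\star$ in finitely many iterations, or $$\|x_{k+1}-x^\star\|\le C_2\|x_k-x^\star\|^{1+\nu}\qquad\text{for every }k\ge K_2.$$ Moreover, in the latter case there exists a constant $\widetilde C_2>0$ such that $$f(x_{k+1})-f(x^\star)\le\widetilde C_2\,(f(x_k)-f(x^\star))^{1+\nu}\qquad\text{for all }k\ge K_2,$$ and both $\|x_k-x^\star\|$ and $f(x_k)-f(x^\star)$ converge to $0$ with Q-order at least $1+\nu$ (Q-quadratically when $\nu=1$).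
   Context: Setting. $\mathcal X\subset\mathbb R^n$ is a nonempty compact convex set; $f:\mathbb R^n\to\mathbb R$ is convex and twice differentiable with $\nabla^2 f(x)$ positive definite for all $x\in\mathcal X$; $x^\star$ is a minimizer of $f$ over $\mathcal X$. $\|\cdot\|$ is the Euclidean norm; $\|y\|_x=\langle\nabla^2f(x)y,y\rangle^{1/2}$, $\|h\|_x^*=\langle h,\nabla^2f(x)^{-1}h\rangle^{1/2}$; for positive definite $H$, $\|y\|_H=\langle Hy,y\rangle^{1/2}$; $D=\sup_{x,y\in\mathcal X}\|x-y\|_x$. The FW gap is $g_k=\max_{v\in\mathcal X}\langle\nabla f(x_k),x_k-v\rangle$. $(2,\nu)$-Hölder condition: for all $x,y\in\mathcal X$, $\sup_{z\ne0}\|(\nabla^2f(x)-\nabla^2f(y))z\|_x^*/\|z\|_x\le L_{2,\nu}\|x-y\|_x^\nu$. Constants. $\kappa_\omega=\frac{1+\sqrt{1+4\omega(1+\rho^{-2})}}{2}$; $B_q=(9L_{2,\nu})^{1/(q-1)}\kappa_\omega^{(q-2)/(q-1)}$. Convergence order. A nonnegative sequence $b_k\to0$ Q-converges with order at least $l>1$ if $b_{k+1}\le Cb_k^l$ eventually for some $C>0$; Q-quadratic means Q-order at least two. Inner procedure FW$(h,H,u,\eta)$. Set $u_0=u$. For $t=0,1,\dots$: take $v_t\in\arg\min_{v\in\mathcal X}\langle h+H(u_t-u),v\rangle$; if $\langle h+H(u_t-u),u_t-v_t\rangle\le\eta$ return $u_t$; otherwise $\gamma_t=\min\{1,\langle h+H(u_t-u),u_t-v_t\rangle/\|v_t-u_t\|_H^2\}$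 and $u_{t+1}=(1-\gamma_t)u_t+\gamma_tv_t$. Inner procedure AFW$(h,H,u,\eta,\mathcal S,\lambda)$ (away-step FW). Here $\mathcal S$ is a finite set of extreme points of $\mathcal X$ and $\lambda$ positive weights on $\mathcal S$ summing to 1 with $u=\sum_{v\in\mathcal S}\lambda_vv$; linear minimization over $\mathcal X$ is assumed to return extreme points. Set $u_0=u,\mathcal S_0=\mathcal S,\lambda_0=\lambda$. For $t=0,1,\dots$, with $G=h+H(u_t-u)$: take $v_t^{FW}\in\arg\min_{v\in\mathcal X}\langle G,v\rangle$; if $\langle G,u_t-v_t^{FW}\rangle\le\eta$ return $(u_t,\mathcal S_t,\lambda_t)$; take $v_t^A\in\arg\max_{v\in\mathcal S_t}\langle G,v\rangle$. If $\langle G,u_t-v_t^{FW}\rangle\ge\langle G,v_t^A-u_t\rangle$ (FW step) put $d_t=u_t-v_t^{FW}$, $\gamma_{t,\max}=1$; otherwise (away step) put $d_t=v_t^A-u_t$, $\gamma_{t,\max}=\lambda_{v_t^A,t}/(1-\lambda_{v_t^A,t})$. Set $\gamma_t=\min\{\gamma_{t,\max},\langle G,d_t\rangle/\|d_t\|_H^2\}$, $u_{t+1}=u_t-\gamma_td_t$. Weights: in an FW step multiply all weights by $1-\gamma_t$ and add $\gamma_t$ to the weight of $v_t^{FW}$ (inserting it in the active set if needed; if $\gamma_t=1$ the active set becomes $\{v_t^{FW}\}$); in an away step multiply all weights by $1+\gamma_t$, subtract $\gamma_t$ from that of $v_t^A$, and remove $v_t^A$ from the active set if its weight becomes 0. Residual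 backtracking update at iteration $k$ (parameters $\rho\in(0,1)$, $\omega>0$, $\bar\theta_0>0$, $\tau>1$; $s_{-1}=0$, $\Delta_{-1}=0$). Set $r_k=\nabla f(x_k)+s_{k-1}$, $\Delta_k=\max\{\|r_k\|_{x_k}^*,\rho\Delta_{k-1}\}$, $\eta_k=\frac{\omega\Delta_k^2}{1+B_q\Delta_k^{(q-2)/(q-1)}}$. For $j=0,1,2,\dots$: $\theta_{k,j}=\min\{\tau^j\bar\theta_k,B_q\Delta_k^{(q-2)/(q-1)}\}$, $\alpha_{k,j}=1/(1+\theta_{k,j})$; $x_{k,j}$ is the point returned by the inner procedure with $h=\nabla f(x_k)$, $H=\alpha_{k,j}^{-1}\nabla^2f(x_k)$, $u=x_k$, $\eta=\eta_k$ (for AFW also the current active set and weights of $x_k$); $s_{k,j}=-\nabla f(x_k)-\alpha_{k,j}^{-1}\nabla^2f(x_k)(x_{k,j}-x_k)$, $w_{k,j}=\nabla f(x_k)+s_{k,j}$, $r_{k+1,j}=\nabla f(x_{k,j})+s_{k,j}$. Accept the first $j$ with $\langle r_{k+1,j},\nabla^2f(x_k)^{-1}w_{k,j}\rangle\ge\frac{c_2}{\alpha_{k,j}\theta_{k,j}}\|r_{k+1,j}\|_{x_k}^{*2}$ and set $\theta_k=\theta_{k,j}$, $x_{k+1}=x_{k,j}$, $s_k=s_{k,j}$, $\bar\theta_{k+1}=\theta_k/\tau$ (for AFW, carry over the accepted active set and weights). Switched method with switching iteration $K$ and exponent $a$. Start at $x_0\in\mathcal X$ (for AFW, an extreme point returned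 by linear minimization, with active set $\{x_0\}$). For $k<K$ use the residual backtracking update. For $k\ge K$: if $g_k=0$, terminate; otherwise run the iterations of the inner procedure with $h=\nabla f(x_k)$, $H=\nabla^2f(x_k)$, $u=x_k$ (i.e. stepsize $\alpha_k=1$), producing $u_0=x_k,u_1,\dots$, but replace its stopping test by the following: with $\Psi_1(u;x_k)=f(x_k)+\langle\nabla f(x_k),u-x_k\rangle+\frac12\|u-x_k\|_{x_k}^2$, $G_t=\max_{v\in\mathcal X}\langle\nabla\Psi_1(u_t;x_k),u_t-v\rangle$, $M_t=f(x_k)-\Psi_1(u_t;x_k)$, stop at $\ell_k(a)=\min\{t\ge0\mid G_t\le(M_t/\|\nabla f(x_k)\|)^a\}$, and set $x_{k+1}=u_{\ell_k(a)}$. *)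

(* Defs.v *)
From HB Require Import structures.
From mathcomp Require Import all_boot all_order all_algebra finmap.
From mathcomp Require Import all_classical all_reals all_analysis.

Set Implicit Arguments.
Unset Strict Implicit.
Unset Printing Implicit Defensive.

Import Order.TTheory GRing.Theory Num.Theory.
Import numFieldNormedType.Exports.

Local Open Scope classical_set_scope.
Local Open Scope ring_scope.

(* Points of R^n are row vectors, so a matrix H acts on y as y *m H.
   The library norm on 'rV[R]_n is the sup norm; it is used here only for the
   topology and for differentiability. The Euclidean norm is [enorm]. *)
Section Euclidean.
Context {R : realType} {n : nat}.
Implicit Types (u v y h : 'rV[R]_n) (H A B : 'M[R]_n).

Definition dot u v : R := \sum_(i < n) u 0 i * v 0 i.

Definition enorm y : R := Num.sqrt (dot y y).

Definition hnorm H y : R := Num.sqrt (dot (y *m H) y).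

Definition dnorm H h : R := Num.sqrt (dot h (h *m invmx H)).

Definition psdmx A := A^T = A /\ forall y, 0 <= dot (y *m A) y.

Definition pdmx A := A^T = A /\ forall y, y != 0 -> 0 < dot (y *m A) y.

Definition loewner_le A B := psdmx (B - A).

End Euclidean.

Section Calculus.
Context {R : realType} {n : nat}.
Implicit Types (X : set 'rV[R]_n) (f : 'rV[R]_n -> R) (x y u v : 'rV[R]_n).

Definition grad f x : 'rV[R]_n := \row_i 'D_(delta_mx 0 i) f x.

(* With 'J in the row convention, y *m hess f x is the derivative of grad f
   at x in the direction y. *)
Definition hess f x : 'M[R]_n := 'J (grad f) x.

Definition twice_differentiable f :=
  (forall x, differentiable f x) /\ (forall x, differentiable (grad f) x).

Definition minimizer X f x := X x /\ forall y, X y -> f x <= f y.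

Definition lin_argmin X g v := X v /\ forall w, X w -> dot g v <= dot g w.

Definition extreme_point X v :=
  X v /\ forall (a b : 'rV[R]_n) (t : R), X a -> X b -> 0 < t -> t < 1 ->
    v = t *: a + (1 - t) *: b -> a = v /\ b = v.

Definition lin_gap X g u : R := sup [set dot g (u - v) | v in X].

Definition fw_gap X f x : R := lin_gap X (grad f x) x.

Definition local_diameter X f : R :=
  sup [set r : R | exists x y, [/\ X x, X y & r = hnorm (hess f x) (x - y)]].

Definition holder2 X f (L2 nu : R) := forall x y, X x -> X y ->
  (ereal_sup [set (dnorm (hess f x) (z *m (hess f x - hess f y))
                     / hnorm (hess f x) z)%:E
               | z in [set z : 'rV[R]_n | z != 0%R]]
   <= (L2 * hnorm (hess f x) (x - y) `^ nu)%:E)%E.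

Definition hess_bounds X f (mu L : R) := forall x, X x ->
  loewner_le mu%:M (hess f x) /\ loewner_le (hess f x) L%:M.

Definition Psi1 f x u : R :=
  f x + dot (grad f x) (u - x) + 2^-1 * hnorm (hess f x) (u - x) ^+ 2.

End Calculus.

(* A weight function is finitely supported. As active weights are positive,
   the active set is the support [finsupp lam], and a vertex whose weight
   becomes 0 leaves it. *)
Definition weights (R : realType) (n : nat) :=
  {fsfun 'rV[R]_n -> R with 0}.

Section InnerProcedures.
Context {R : realType} {n : nat}.
Implicit Types (X : set 'rV[R]_n) (H : 'M[R]_n) (g h u v z : 'rV[R]_n).

Implicit Types (lam : weights R n).

Definition qgrad h H u y := h + (y - u) *m H.

(* The stopping test [stop u_t v_t] sees the iterate and the answer of the
   linear minimization at that iterate. *)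
Definition FW_returns X h H u (stop : 'rV[R]_n -> 'rV[R]_n -> Prop) z :=
  exists (us vs : nat -> 'rV[R]_n) (T : nat),
    [/\ us 0%N = u,
        forall t, (t <= T)%N -> lin_argmin X (qgrad h H u (us t)) (vs t),
        forall t, (t < T)%N -> ~ stop (us t) (vs t) /\
          let gam := Num.min 1 (dot (qgrad h H u (us t)) (us t - vs t)
                                / hnorm H (vs t - us t) ^+ 2) in
          us t.+1 = (1 - gam) *: us t + gam *: vs t,
        stop (us T) (vs T)
      & z = us T].

Definition AFW_step g H u lam vF vA u' lam' :=
  let gapF := dot g (u - vF) in
  let gapA := dot g (vA - u) in
  if gapA <= gapF then
    let d := u - vF in
    let gam := Num.min 1 (dot g d / hnorm H d ^+ 2) in
    u' = u - gam *: d /\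
    forall w, lam' w = (1 - gam) * lam w + gam * (w == vF)%:R
  else
    let d := vA - u in
    let gam := Num.min (lam vA / (1 - lam vA)) (dot g d / hnorm H d ^+ 2) in
    u' = u - gam *: d /\
    forall w, lam' w = (1 + gam) * lam w - gam * (w == vA)%:R.

Definition AFW_returns X h H u lam
    (stop : 'rV[R]_n -> 'rV[R]_n -> Prop) z lamz :=
  exists (us vF vA : nat -> 'rV[R]_n) (lams : nat -> weights R n) (T : nat),
    [/\ us 0%N = u /\ lams 0%N = lam,
        forall t, (t <= T)%N ->
          lin_argmin X (qgrad h H u (us t)) (vF t) /\ extreme_point X (vF t),
        forall t, (t < T)%N ->
          [/\ ~ stop (us t) (vF t),
              vA t \in finsupp (lams t),
              forall w, w \in finsupp (lams t) ->
                dot (qgrad h H u (us t)) w <= dot (qgrad h H u (us t)) (vA t)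
            & AFW_step (qgrad h H u (us t)) H (us t) (lams t) (vF t) (vA t)
                (us t.+1) (lams t.+1)],
        stop (us T) (vF T)
      & z = us T /\ lamz = lams T].

Inductive inner_kind := FW | AFW.

(* FW maintains no weights: [lam] and [lamz] are irrelevant for it. *)
Definition inner_returns (m : inner_kind) X h H u lam
    (stop : 'rV[R]_n -> 'rV[R]_n -> Prop) z lamz :=
  match m with
  | FW => FW_returns X h H u stop z
  | AFW => AFW_returns X h H u lam stop z lamz
  end.

End InnerProcedures.

Section Method.
Context {R : realType} {n : nat}.
Implicit Types (X : set 'rV[R]_n) (f : 'rV[R]_n -> R) (K : option nat).

Definition kappa (omega rho : R) : R :=
  (1 + Num.sqrt (1 + 4 * omega * (1 + (rho ^+ 2)^-1))) / 2.

Definition B_const (q L2 omega rho : R) : R :=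
  (9 * L2) `^ (1 / (q - 1)) * kappa omega rho `^ ((q - 2) / (q - 1)).

(* State at the start of iteration k: x_k, its weights (for AFW), s_{k-1},
   Delta_{k-1} and thetabar_k. *)
Record state := State {
  st_x : 'rV[R]_n;
  st_lam : weights R n;
  st_s : 'rV[R]_n;
  st_Delta : R;
  st_thbar : R }.
Implicit Types (st : state).

Definition residual_step (m : inner_kind) X f
    (q L2 rho omega tau c2 : R) st st' :=
  let x := st_x st in
  let g := grad f x in
  let H := hess f x in
  let Delta := Num.max (dnorm H (g + st_s st)) (rho * st_Delta st) in
  let thmax := B_const q L2 omega rho * Delta `^ ((q - 2) / (q - 1)) in
  let eta := omega * Delta ^+ 2 / (1 + thmax) in
  let th j := Num.min (tau ^+ j * st_thbar st) thmax in
  let al j := 1 / (1 + th j) in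
  let Ha j := (al j)^-1 *: H in
  let stop j u v := dot (qgrad g (Ha j) x u) (u - v) <= eta in
  let s j (y : 'rV[R]_n) := - g - (y - x) *m Ha j in
  let w j y := g + s j y in
  let r j y := grad f y + s j y in
  let accept j y :=
    c2 / (al j * th j) * dnorm H (r j y) ^+ 2
      <= dot (r j y) (w j y *m invmx H) in
  exists (j : nat) (y : nat -> 'rV[R]_n) (lamy : nat -> weights R n),
    [/\ forall i, (i <= j)%N ->
          inner_returns m X g (Ha i) x (st_lam st) (stop i) (y i) (lamy i),
        forall i, (i < j)%N -> ~~ accept i (y i),
        accept j (y j)
      & st' = State (y j) (lamy j) (s j (y j)) Delta (th j / tau)].

(* After termination the sequence is continued as a constant. *)
Definition newton_step (m : inner_kind) X f (a : R) st st' :=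
  let x := st_x st in
  let g := grad f x in
  let H := hess f x in
  let stop (u _ : 'rV[R]_n) :=
    lin_gap X (grad (Psi1 f x) u) u
      <= ((f x - Psi1 f x u) / enorm g) `^ a in
  if fw_gap X f x == 0 then st_x st' = x
  else inner_returns m X g H x (st_lam st) stop (st_x st') (st_lam st').

Definition init_state (m : inner_kind) X (thbar0 : R) st :=
  [/\ X (st_x st), st_s st = 0, st_Delta st = 0, st_thbar st = thbar0 &
      m = AFW ->
      [/\ exists g, lin_argmin X g (st_x st), extreme_point X (st_x st)
        & forall w, st_lam st w = (w == st_x st)%:R]].

(* An iteration number in N + {oo}; None stands for oo. *)
Definition before (k : nat) K := if K is Some N then (k < N)%N else true.

Definition is_first (P : nat -> Prop) K :=
  match K with
  | Some N => P N /\ forall k, (k < N)%N -> ~ P k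
  | None => forall k, ~ P k
  end.

Definition switched_method (m : inner_kind) X f
    (q L2 rho omega thbar0 tau c2 : R) K (a : R) (x : nat -> 'rV[R]_n) :=
  exists st : nat -> state,
    [/\ init_state m X thbar0 (st 0%N),
        forall k, if before k K
          then residual_step m X f q L2 rho omega tau c2 (st k) (st k.+1)
          else newton_step m X f a (st k) (st k.+1)
      & forall k, x k = st_x (st k)].

Definition C2_const (nu L2 mu L D : R) : R :=
  L2 * L `^ ((1 + nu) / 2) / ((1 + nu) * Num.sqrt mu)
  + Num.sqrt (2 / mu)
    * (1 + L2 * L `^ ((1 + nu) / 2) * D `^ nu
             / ((1 + nu) * mu `^ ((1 + nu) / 2))) `^ (1 + nu).

Definition Q_order_at_least (l : R) (b : nat -> R) :=
  [/\ 1 < l, forall k, 0 <= b k, b k @[k --> \oo] --> (0 : R)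
    & exists2 C : R, 0 < C & \forall k \near \oo, b k.+1 <= C * b k `^ l].

Definition Q_quadratic (b : nat -> R) := Q_order_at_least 2 b.

End Method.

(* Main.v *)
(** Before the switch the function f(x_k) + C Delta_k^p, with p = q/(q-1) and C a
    multiple of rho^2/B_q, decreases by at least a fixed multiple of Delta_k^p at
    every iteration: the acceptance test gives the descent, the inner stopping
    test costs at most omega Delta_k^p / B_q, and the bound on omega makes the
    balance positive.  The Frank-Wolfe gap at x_k is bounded in terms of Delta_k,
    so it cannot stay above a positive threshold, and K_2 is finite.

    After the switch let u be the point returned from x, let xhat minimize the
    quadratic model Psi at x over X, let G be the model gap at u and let e be the
    Hoelder remainder of the gradient between x and x*.  Adding the gap inequality at u
    and the optimality of x* gives d^2 <= e d + G for d = |u - x*|_x, so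
    d <= e + sqrt G.  The same estimate with G = 0 gives |xhat - x*|_x <= e, and the
    stopping rule gives G <= |x - xhat|^(2(1+nu)), because the line searches do not
    increase Psi and Psi(x) - Psi(xhat) <= |grad f(x)| |x - xhat|.  Hence d is of
    order |x - x*|^(1+nu).  Convexity of f at u turns this into the rate for the values,
    and the threshold defining K_2 makes C_2 |x - x*|^nu at most 1/2, whence
    convergence. *)

Require Import Defs.
From HB Require Import structures.
From mathcomp Require Import all_boot all_order all_algebra finmap.
From mathcomp Require Import all_classical all_reals all_analysis.
From mathcomp Require Import ring lra.

Set Implicit Arguments.
Unset Strict Implicit.
Unset Printing Implicit Defensive.

Import Order.TTheory GRing.Theory Num.Theory.
Import numFieldNormedType.Exports.

Local Open Scope classical_set_scope.
Local Open Scope ring_scope.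

(** * Quadratic forms and their norms *)

Section Forms.
Context {R : realType} {n : nat}.
Implicit Types (u v w y z h : 'rV[R]_n) (A H : 'M[R]_n) (a : R).

Lemma dot_sum u v : dot u v = \sum_(i < n) u 0 i * v 0 i.
Proof. by []. Qed.

Lemma dotE u v : dot u v = (u *m v^T) 0 0.
Proof. by rewrite /dot mxE; apply: eq_bigr => i _; rewrite mxE. Qed.

Lemma dotC u v : dot u v = dot v u.
Proof. by apply: eq_bigr => i _; rewrite mulrC. Qed.

Lemma dotDl u v w : dot (u + v) w = dot u w + dot v w.
Proof. by rewrite !dotE mulmxDl mxE. Qed.

Lemma dotZl a u v : dot (a *: u) v = a * dot u v.
Proof. by rewrite !dotE -scalemxAl mxE. Qed.

Lemma dotNl u v : dot (- u) v = - dot u v.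
Proof. by rewrite -scaleN1r dotZl mulN1r. Qed.

Lemma dotBl u v w : dot (u - v) w = dot u w - dot v w.
Proof. by rewrite dotDl dotNl. Qed.

Lemma dot0l u : dot 0 u = 0.
Proof. by rewrite -(scale0r 0) dotZl mul0r. Qed.

Lemma dotDr u v w : dot w (u + v) = dot w u + dot w v.
Proof. by rewrite dotC dotDl !(dotC w). Qed.

Lemma dotZr a u v : dot v (a *: u) = a * dot v u.
Proof. by rewrite dotC dotZl dotC. Qed.

Lemma dotNr u v : dot v (- u) = - dot v u.
Proof. by rewrite dotC dotNl dotC. Qed.

Lemma dotBr u v w : dot w (u - v) = dot w u - dot w v.
Proof. by rewrite dotDr dotNr. Qed.

Lemma dot0r u : dot u 0 = 0.
Proof. by rewrite dotC dot0l. Qed.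

Lemma dot_mulmx A u v : dot (u *m A) v = dot u (v *m A^T).
Proof. by rewrite !dotE trmx_mul trmxK mulmxA. Qed.

Lemma dot_ge0 u : 0 <= dot u u.
Proof. by apply: sumr_ge0 => i _; rewrite -expr2 sqr_ge0. Qed.

Lemma dot_eq0 u : (dot u u == 0) = (u == 0).
Proof.
apply/idP/eqP => [|->]; last by rewrite dot0l.
rewrite psumr_eq0 => [/allP u0|i _]; last by rewrite -expr2 sqr_ge0.
apply/rowP => i; rewrite mxE; apply/eqP; rewrite -sqrf_eq0 expr2.
exact: u0 (mem_index_enum i).
Qed.

Lemma psdmx_scalar a : 0 <= a -> psdmx (a%:M : 'M[R]_n).
Proof.
move=> a0; split=> [|y]; first by rewrite tr_scalar_mx.
by rewrite mul_mx_scalar dotZl mulr_ge0// dot_ge0.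
Qed.

Lemma pd_psdmx A : pdmx A -> psdmx A.
Proof.
move=> [sA pA]; split=> // y; have [->|/pA/ltW//] := eqVneq y 0.
by rewrite dot0r.
Qed.

Lemma psdmxZ a A : 0 <= a -> psdmx A -> psdmx (a *: A).
Proof.
move=> a0 [sA pA]; split=> [|y]; first by rewrite linearZ /= sA.
by rewrite -scalemxAr dotZl mulr_ge0.
Qed.

Lemma dot_symC A u v : A^T = A -> dot (u *m A) v = dot (v *m A) u.
Proof. by move=> sA; rewrite dot_mulmx sA dotC. Qed.

Lemma quad_expand A u v a : A^T = A ->
  dot ((u + a *: v) *m A) (u + a *: v) =
  dot (u *m A) u + 2 * a * dot (u *m A) v + a ^+ 2 * dot (v *m A) v.
Proof.
move=> sA; rewrite mulmxDl -scalemxAl !(dotDl, dotDr, dotZl, dotZr).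
by rewrite (dot_symC v u sA); ring.
Qed.

(** The form at u + t v is a nonnegative quadratic in t; evaluating it at its vertex gives the
    bound. As A is only semidefinite, v may be a degenerate direction, treated apart. *)
Lemma psd_cauchy_schwarz_sqr A u v : psdmx A ->
  dot (u *m A) v ^+ 2 <= dot (u *m A) u * dot (v *m A) v.
Proof.
move=> [sA pA]; set b := dot (u *m A) v; set c := dot (v *m A) v.
set a := dot (u *m A) u.
have E t : 0 <= a + 2 * t * b + t ^+ 2 * c by rewrite -quad_expand.
have c0 : 0 <= c by exact: pA.
have a0 : 0 <= a by exact: pA.
have [cz|cn] := eqVneq c 0.
  have [->|bn] := eqVneq b 0; first by rewrite expr0n mulr_ge0.
  (* With c = 0 the form a + 2 t b is affine in t; this t gives it the value -1. *)
  have := E (- (a + 1) / (2 * b)); rewrite cz mulr0 addr0.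
  rewrite -mulrA mulrCA -mulrA.
  rewrite (_ : - (a + 1) * _ = - (a + 1)); first lra.
  by field.
have := E (- b / c).
rewrite (_ : _ + _ = (a * c - b ^+ 2) / c); last by field.
by rewrite pmulr_lge0 ?invr_gt0 ?lt_def ?cn//; lra.
Qed.

Lemma hnorm_ge0 A u : 0 <= hnorm A u.
Proof. exact: sqrtr_ge0. Qed.

Lemma enorm_ge0 u : 0 <= enorm u.
Proof. exact: sqrtr_ge0. Qed.

Lemma hnorm_sqr A u : psdmx A -> hnorm A u ^+ 2 = dot (u *m A) u.
Proof. by move=> [_ pA]; rewrite sqr_sqrtr. Qed.

Lemma enorm_sqr u : enorm u ^+ 2 = dot u u.
Proof. by rewrite sqr_sqrtr// dot_ge0. Qed.

Lemma hnorm1 u : hnorm 1%:M u = enorm u.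
Proof. by rewrite /hnorm mulmx1. Qed.

Lemma psd_cauchy_schwarz A u v : psdmx A ->
  dot (u *m A) v <= hnorm A u * hnorm A v.
Proof.
move=> pA; apply: le_trans (ler_norm _) _.
rewrite -sqrtr_sqr -sqrtrM; last by case: pA.
by apply/ler_wsqrtr/psd_cauchy_schwarz_sqr.
Qed.

Lemma cauchy_schwarz u v : dot u v <= enorm u * enorm v.
Proof.
rewrite -!hnorm1 -{1}(mulmx1 u).
exact: psd_cauchy_schwarz (psdmx_scalar ler01).
Qed.

Lemma hnormN A u : hnorm A (- u) = hnorm A u.
Proof. by rewrite /hnorm mulNmx dotNl dotNr opprK. Qed.

Lemma hnormB A u v : hnorm A (u - v) = hnorm A (v - u).
Proof. by rewrite -hnormN opprB. Qed.

Lemma hnormZ A a u : psdmx A -> 0 <= a -> hnorm A (a *: u) = a * hnorm A u.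
Proof.
move=> [_ pA] a0; rewrite /hnorm -scalemxAl dotZl dotZr mulrA -expr2.
by rewrite sqrtrM ?sqr_ge0// sqrtr_sqr ger0_norm.
Qed.

Lemma hnorm0 A : hnorm A 0 = 0.
Proof. by rewrite /hnorm dot0r sqrtr0. Qed.

Lemma hnormD A u v : psdmx A -> hnorm A (u + v) <= hnorm A u + hnorm A v.
Proof.
move=> pA; rewrite -(@ler_pXn2r _ 2)// ?nnegrE ?addr_ge0 ?hnorm_ge0//.
rewrite hnorm_sqr// -[v in X in X <= _]scale1r quad_expand; last by case: pA.
rewrite sqrrD !hnorm_sqr//.
by have := psd_cauchy_schwarz u v pA; lra.
Qed.

Lemma hnorm_tri A u v w : psdmx A ->
  hnorm A (u - w) <= hnorm A (u - v) + hnorm A (v - w).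
Proof. by move=> pA; rewrite -(subrKA v u (- w)) hnormD. Qed.

Lemma enormB u v : enorm (u - v) = enorm (v - u).
Proof. by rewrite -!hnorm1 hnormB. Qed.

Lemma enorm_tri u v w : enorm (u - w) <= enorm (u - v) + enorm (v - w).
Proof. by rewrite -!hnorm1 (hnorm_tri _ _ _ (psdmx_scalar ler01)). Qed.

Lemma enorm_eq0 u : (enorm u == 0) = (u == 0).
Proof. by rewrite -sqrf_eq0 enorm_sqr dot_eq0. Qed.

Lemma hnorm_gt0 A u : pdmx A -> u != 0 -> 0 < hnorm A u.
Proof. by move=> [_ pA] /pA; rewrite sqrtr_gt0. Qed.

Lemma pdmx_unit A : pdmx A -> A \in unitmx.
Proof.
move=> [_ pA]; rewrite -row_free_unit -kermx_eq0.
apply/eqP/row_matrixP => i; rewrite row0; apply/eqP/negPn/negP => /pA.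
have /sub_kermxP -> : (row i (kermx A) <= kermx A)%MS by exact: row_sub.
by rewrite dot0l ltxx.
Qed.

Lemma dnormE A h : pdmx A -> dnorm A h = hnorm A (h *m invmx A).
Proof. by move=> pA; rewrite /dnorm /hnorm mulmxKV// pdmx_unit. Qed.

Lemma dnorm_ge0 A h : 0 <= dnorm A h.
Proof. exact: sqrtr_ge0. Qed.

Lemma dnorm_dual A h v : pdmx A -> dot h v <= dnorm A h * hnorm A v.
Proof.
move=> pA; rewrite dnormE// -{1}(mulmxKV (pdmx_unit pA) h).
exact/psd_cauchy_schwarz/pd_psdmx.
Qed.

Lemma dnorm_sqr A h : pdmx A -> dnorm A h ^+ 2 = dot h (h *m invmx A).
Proof.
move=> pA; rewrite dnormE// hnorm_sqr ?mulmxKV// ?pdmx_unit//.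
exact: pd_psdmx.
Qed.

Lemma mulmxB_bound A B z w (c : R) :
  (forall w', dot (z *m (A - B)) w' <= c * hnorm A w') ->
  `|dot (z *m A) w - dot (z *m B) w| <= c * hnorm A w.
Proof.
move=> h; have := h w; have := h (- w).
by rewrite hnormN mulmxBr dotNr dotBl ler_norml; lra.
Qed.

Lemma enorm_le_hnorm (mu : R) A u : 0 <= mu -> loewner_le mu%:M A -> psdmx A ->
  Num.sqrt mu * enorm u <= hnorm A u.
Proof.
move=> mu0 [_ /(_ u)]; rewrite mulmxBr mul_mx_scalar dotBl dotZl => le [_ pA].
by rewrite -sqrtrM// ler_sqrt ?pA//; lra.
Qed.

Lemma hnorm_le_enorm (L : R) A u : 0 <= L -> loewner_le A L%:M ->
  hnorm A u <= Num.sqrt L * enorm u.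
Proof.
move=> L0 [_ /(_ u)]; rewrite mulmxBr mul_mx_scalar dotBl dotZl => le.
by rewrite -sqrtrM// ler_sqrt ?mulr_ge0 ?dot_ge0//; lra.
Qed.

(** For z = h A^-1 the squared dual norm is <h, z>, at most |h| |z|, while the dual norm is also the
    A-norm of z and so dominates sqrt mu |z|. One factor of the dual norm cancels. *)
Lemma dnorm_le_enorm (mu : R) A h : 0 < mu -> loewner_le mu%:M A -> pdmx A ->
  mu * dnorm A h ^+ 2 <= enorm h ^+ 2.
Proof.
move=> mu0 lA pA; set z := h *m invmx A.
have e1 : dnorm A h ^+ 2 <= enorm h * enorm z.
  by rewrite dnorm_sqr// cauchy_schwarz.
have e2 : Num.sqrt mu * enorm z <= dnorm A h.
  by rewrite dnormE// enorm_le_hnorm ?ltW//; exact: pd_psdmx.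
have d0 := dnorm_ge0 A h.
have m0 : 0 < Num.sqrt mu by rewrite sqrtr_gt0.
have e3 : Num.sqrt mu * dnorm A h ^+ 2 <= enorm h * dnorm A h.
  have : Num.sqrt mu * dnorm A h ^+ 2 <= Num.sqrt mu * (enorm h * enorm z).
    by rewrite ler_pM2l.
  have : enorm h * (Num.sqrt mu * enorm z) <= enorm h * dnorm A h.
    by rewrite ler_wpM2l ?enorm_ge0.
  lra.
have [->|dn] := eqVneq (dnorm A h) 0.
  by rewrite expr0n mulr0 sqr_ge0.
have e4 : Num.sqrt mu * dnorm A h <= enorm h.
  by rewrite -(@ler_pM2r _ (dnorm A h)) ?lt_def ?dn// -mulrA -expr2.
by rewrite -{1}(sqr_sqrtr (ltW mu0)) -exprMn lerXn2r// nnegrE ?mulr_ge0 ?enorm_ge0// ltW.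
Qed.

Lemma enorm_le_dnorm (L : R) A h : 0 < L -> loewner_le A L%:M -> pdmx A ->
  enorm h ^+ 2 <= L * dnorm A h ^+ 2.
Proof.
move=> L0 lA pA.
have e1 : enorm h ^+ 2 <= dnorm A h * (Num.sqrt L * enorm h).
  rewrite enorm_sqr; apply: le_trans (dnorm_dual h h pA) _.
  by rewrite ler_wpM2l ?dnorm_ge0// hnorm_le_enorm// ltW.
have [->|hn] := eqVneq (enorm h) 0.
  by rewrite expr0n mulr_ge0 ?sqr_ge0// ltW.
have e2 : enorm h <= Num.sqrt L * dnorm A h.
  rewrite -(@ler_pM2r _ (enorm h)) ?lt_def ?hn ?enorm_ge0//.
  by rewrite -expr2 (le_trans e1)// mulrCA mulrA.
rewrite -{1}(sqr_sqrtr (ltW L0)) -exprMn lerXn2r// nnegrE.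
  exact: enorm_ge0.
by rewrite mulr_ge0 ?dnorm_ge0 ?sqrtr_ge0.
Qed.

Lemma mx_upper_bound A :
  exists2 c : R, 0 < c & forall y, dot (y *m A) y <= c * dot y y.
Proof.
(* Each |y_j y_i| is at most |y|^2, so the sum of the entries in absolute value suffices; the 1
   keeps the constant positive. *)
exists (1 + \sum_(i < n) \sum_(j < n) `|A j i|).
  by rewrite ltr_wpDr// sumr_ge0// => i _; rewrite sumr_ge0.
move=> y; rewrite mulrDl mul1r ler_wpDl ?dot_ge0//.
rewrite {1}/dot mulr_suml ler_sum// => i _.
rewrite mxE !mulr_suml ler_sum// => j _.
have le k : y 0 k ^+ 2 <= dot y y.
  by rewrite /dot (bigD1 k)//= -expr2 lerDl sumr_ge0// => l _; rewrite -expr2 sqr_ge0.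
have yy : `|y 0 j * y 0 i| <= dot y y.
  have := le i; have := le j.
  rewrite normrM -(real_normK (num_real (y 0 i))) -(real_normK (num_real (y 0 j))).
  set a := `|y 0 i|; set b := `|y 0 j| => ha hb.
  by have : 0 <= (a - b) ^+ 2 by [exact: sqr_ge0]; lra.
rewrite mulrAC mulrC (le_trans (ler_norm _))// normrM.
by rewrite ler_wpM2l.
Qed.

(* |y|^2 = <y A, y A^-1>, so Cauchy-Schwarz for A bounds |y| by the A-norm and
   the size of A^-1: no eigenvalue is needed. *)
Lemma pdmx_lower_bound A : pdmx A ->
  exists2 c : R, 0 < c & forall y, c * dot y y <= dot (y *m A) y.
Proof.
move=> pA; have uA := pdmx_unit pA.
have [C C0 hC] := mx_upper_bound (invmx A).
exists C^-1; first by rewrite invr_gt0.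
move=> y; rewrite mulrC ler_pdivrMr//.
have := psd_cauchy_schwarz_sqr y (y *m invmx A) (pd_psdmx pA).
rewrite mulmxKV// (dotC y (y *m invmx A)); case: (pA) => sA nA.
have -> : dot (y *m A) (y *m invmx A) = dot y y.
  by rewrite dotC -{2}sA -dot_mulmx mulmxKV.
move=> e; have [->|yn] := eqVneq y 0; first by rewrite mul0mx !dot0l mul0r.
have yy : 0 < dot y y by rewrite lt_def dot_ge0 dot_eq0 yn.
rewrite -(ler_pM2r yy); apply: le_trans (_ : dot (y *m A) y * (C * dot y y) <= _).
  by rewrite -expr2 (le_trans e)// ler_wpM2l ?hC// ltW// nA.
by rewrite mulrA.
Qed.

End Forms.

(** * Calculus along lines *)

Section Lines.
Context {R : realType} {n : nat}.
Implicit Types (x y d z : 'rV[R]_n) (t : R).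

Lemma derive_grad (f : 'rV[R]_n -> R) x d :
  differentiable f x -> 'D_d f x = dot (grad f x) d.
Proof.
move=> df; rewrite deriveE// {1}(row_sum_delta d) raddf_sum /=.
apply: eq_bigr => i _; rewrite linearZ /= -deriveE// mulrC /grad mxE.
by [].
Qed.

Lemma gradE (f : 'rV[R]_n -> R) x i : grad f x 0 i = 'D_(delta_mx 0 i) f x.
Proof. by rewrite mxE. Qed.

Lemma derive_hess (f : 'rV[R]_n -> R) x d :
  differentiable (grad f) x -> 'D_d (grad f) x = d *m hess f x.
Proof. by move=> dg; rewrite deriveEjacobian. Qed.

Lemma is_derive_dot (F : 'rV[R]_n -> 'rV[R]_n) x d z : differentiable F x ->
  is_derive x d (fun y => dot (F y) z) (dot ('D_d F x) z).
Proof.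
move=> dF; have dd := diff_derivable (v := d) dF.
have -> : (fun y => dot (F y) z) =
  \sum_(i < n) ((z 0 i) \*: (fun y => F y 0 i)).
  apply/funext => y; rewrite fct_sumE; apply: eq_bigr => i _.
  by rewrite /= mulrC.
rewrite /dot (derive_mx dd).
under [X in is_derive _ _ _ X]eq_bigr do rewrite mxE mulrC.
apply: is_derive_sum => i; apply: is_deriveZ; apply: DeriveDef => //.
by have /derivable_mxP/(_ 0 i) := dd.
Qed.

(** Both functions have the same difference quotients, so a derivative of F in the single direction
    d is enough. *)
Lemma is_derive_line (W : normedModType R) (F : 'rV[R]_n -> W) x d t a :
  is_derive (x + t *: d) d F a -> is_derive t 1 (fun s : R => F (x + s *: d)) a.
Proof.
have E : (fun h : R => h^-1 *:
      (((fun s : R => F (x + s *: d)) \o shift t) (h *: 1) - F (x + t *: d)))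
   = (fun h : R => h^-1 *: ((F \o shift (x + t *: d)) (h *: d) - F (x + t *: d))).
  apply/funext => h /=; congr (_ *: (F _ - _)).
  by rewrite scalerDl [h *: 1]mulr1 addrCA.
by case=> dF <-; apply: DeriveDef; rewrite /derivable /derive E.
Qed.

Lemma is_derive1_continuous (F : R -> R) a t : is_derive t 1 F a ->
  {for t, continuous F}.
Proof. by case=> dF _; apply/differentiable_continuous/derivable1_diffP. Qed.

(** Derivatives are asked only at interior points because [holder_taylor] applies this to t^(1+nu),
    which is differentiated only for t > 0. *)
Lemma ge0_derive_le01 (F dF : R -> R) :
  (forall t, 0 < t -> t < 1 -> is_derive t 1 F (dF t)) ->
  {within `[0, 1], continuous F} ->
  (forall t, 0 < t -> t < 1 -> 0 <= dF t) -> F 0 <= F 1.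
Proof.
move=> D C P.
have D' (t : R) : t \in `]0, 1[ -> is_derive t 1 F (dF t).
  by rewrite in_itv /= => /andP[t0 t1]; exact: D.
have [c + e] := MVT ltr01 D' C.
rewrite in_itv /= => /andP[c0 c1]; move: e; rewrite subr0 mulr1 => e.
by have := P c c0 c1; rewrite -e subr_ge0.
Qed.

Lemma continuous_powR_itv (p : R) : 0 < p ->
  {within `[0, 1], continuous (fun t : R => t `^ p)}.
Proof.
move=> p0; apply/continuous_within_itvP; first exact: ltr01.
have C (t : R) : 0 < t -> {for t, continuous (fun t : R => t `^ p)}.
  by move=> t0; apply: is_derive1_continuous (is_derive1_powR _ _).
split=> [t||].
- by rewrite in_itv /= => /andP[t0 _]; exact: C.
- by rewrite powR0 ?gt_eqF//; exact: powR_cvg0.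
- by apply: cvg_at_left_filter; exact: C.
Qed.

End Lines.

(** * Hoelder Hessians on a convex set *)

Section Smoothness.
Context {R : realType} {n : nat}.
Implicit Types (x y d z u v w : 'rV[R]_n) (t : R).

Lemma convex_setP (X : set 'rV[R]_n) x y t : convex_set X -> X x -> X y ->
  0 <= t -> t <= 1 -> X (x + t *: (y - x)).
Proof.
move=> cX Xx Xy t0 t1.
have /set_mem := cX y x (Itv01 t0 t1) (mem_set Xy) (mem_set Xx).
rewrite /conv /=; congr (X _).
by rewrite scalerBr scalerBl scale1r addrCA.
Qed.

Lemma sub_line x y t : x + t *: (y - x) - x = t *: (y - x).
Proof. by rewrite addrC addKr. Qed.

Lemma line1 x y : x + 1 *: (y - x) = y.
Proof. by rewrite scale1r addrC subrK. Qed.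

Lemma line0 x d : x + 0 *: d = x.
Proof. by rewrite scale0r addr0. Qed.

Lemma is_derive_mulr_cst (c t : R) : is_derive t 1 (fun s : R => s * c) c.
Proof.
have -> : (fun s : R => s * c) = c \*: id.
  by apply/funext => s; rewrite /GRing.scale /= mulrC.
exact: (is_derive_eq (is_deriveZ c (is_derive_id t (1:R))) (mulr1 c)).
Qed.

Lemma is_derive_sqr_cst (c t : R) :
  is_derive t 1 (fun s : R => s * s * c) (2 * t * c).
Proof.
have -> : (fun s : R => s * s * c) = c \*: (id * id).
  by apply/funext => s; rewrite /GRing.scale /= mulrC.
have D1 := is_derive_id t (1 : R).
apply: (is_derive_eq (is_deriveZ c (is_deriveM D1 D1))).
by rewrite /GRing.scale /=; lra.
Qed.

(** For 0 < h <= 1 the point x + h (v - x) stays in X, so the difference quotients from the right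
    are nonnegative, and so is their limit. *)
Lemma first_order_optimality (X : set 'rV[R]_n) (f : 'rV[R]_n -> R) x v :
  convex_set X -> differentiable f x -> minimizer X f x -> X v ->
  0 <= dot (grad f x) (v - x).
Proof.
move=> cX df [Xx mx] Xv; rewrite -derive_grad//.
have /cvg_dnbhs_at_right C : (fun h : R => h^-1 *: ((f \o shift x) (h *: (v - x)) - f x)) h
    @[h --> 0^'] --> 'D_(v - x) f x by exact: diff_derivable.
apply: (cvgr_to_ge C); near=> h; have h0 : 0 < h by near: h; exact: nbhs_right_gt.
have h1 : h <= 1 by near: h; apply: nbhs_right_le.
have : 0 <= f (x + h *: (v - x)) - f x.
  by rewrite subr_ge0 mx//; apply: convex_setP => //; exact: ltW.
rewrite [x + _]addrC => le; have := mulr_ge0 (ltW (eqbRL (invr_gt0 h) h0)) le; exact.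
Unshelve. all: by end_near. Qed.

Context (X : set 'rV[R]_n) (f : 'rV[R]_n -> R).
Hypotheses (X_convex : convex_set X) (f_diff2 : twice_differentiable f).
Hypothesis f_pd : forall x, X x -> pdmx (hess f x).

Lemma is_derive_f_line x d t :
  is_derive t 1 (fun s : R => f (x + s *: d)) (dot (grad f (x + t *: d)) d).
Proof.
case: f_diff2 => df _; rewrite -derive_grad//; apply: is_derive_line.
by apply: DeriveDef => //; exact: diff_derivable.
Qed.

Lemma is_derive_grad_line x d w t :
  is_derive t 1 (fun s : R => dot (grad f (x + s *: d)) w)
    (dot (d *m hess f (x + t *: d)) w).
Proof.
case: f_diff2 => _ dg; rewrite -derive_hess//.
by apply: (is_derive_line (F := fun y => dot (grad f y) w)); exact: is_derive_dot.
Qed.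

Lemma grad_monotone mu x y : (forall z, X z -> loewner_le mu%:M (hess f z)) ->
  X x -> X y -> mu * dot (y - x) (y - x) <= dot (grad f y - grad f x) (y - x).
Proof.
move=> hmu Xx Xy; set d := y - x.
pose F t := dot (grad f (x + t *: d)) d - t * (mu * dot d d).
have D t : is_derive t 1 F (dot (d *m hess f (x + t *: d)) d - mu * dot d d).
  apply: is_deriveB; first exact: is_derive_grad_line.
  exact: is_derive_mulr_cst.
have : F 0 <= F 1.
  apply: (ge0_derive_le01 (fun t _ _ => D t)) => [|t t0 t1].
    by apply: continuous_subspaceT => t; exact: is_derive1_continuous (D t).
  have [_ /(_ d)] := hmu _ (convex_setP X_convex Xx Xy (ltW t0) (ltW t1)).
  by rewrite mulmxBr mul_mx_scalar dotBl dotZl.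
by rewrite /F line0 line1 dotBl; lra.
Qed.

Lemma strong_convexity mu x y : (forall z, X z -> loewner_le mu%:M (hess f z)) ->
  X x -> X y ->
  f x + dot (grad f x) (y - x) + mu / 2 * dot (y - x) (y - x) <= f y.
Proof.
move=> hmu Xx Xy; set d := y - x.
pose F t := f (x + t *: d) - (t * dot (grad f x) d + t * t * (mu / 2 * dot d d)).
have D t : is_derive t 1 F
    (dot (grad f (x + t *: d)) d - (dot (grad f x) d + t * (mu * dot d d))).
  apply: is_deriveB; first exact: is_derive_f_line.
  rewrite [t * _](_ : _ = 2 * t * (mu / 2 * dot d d)); last by lra.
  by apply: is_deriveD; [exact: is_derive_mulr_cst|exact: is_derive_sqr_cst].
have : F 0 <= F 1.
  apply: (ge0_derive_le01 (fun t _ _ => D t)) => [|t t0 t1].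
    by apply: continuous_subspaceT => t; exact: is_derive1_continuous (D t).
  have Xt := convex_setP X_convex Xx Xy (ltW t0) (ltW t1).
  have := grad_monotone hmu Xx Xt; rewrite sub_line -/d dotBl !(dotZl, dotZr).
  (* Monotonicity between x and x + t d carries a common factor t, cancelled as t > 0. *)
  by rewrite -mulrBr mulrCA ler_pM2l//; lra.
by rewrite /F line0 line1; lra.
Qed.

Context (nu L2 : R).
Hypotheses (nu_gt0 : 0 < nu) (L2_gt0 : 0 < L2) (f_holder : holder2 X f L2 nu).

(** Duality turns the operator bound into a bilinear one. The case z = 0 is separate because the
    supremum runs over nonzero z. *)
Lemma holder_form x y z w : X x -> X y ->
  `|dot (z *m hess f x) w - dot (z *m hess f y) w| <=
  L2 * hnorm (hess f x) (x - y) `^ nu * hnorm (hess f x) z * hnorm (hess f x) w.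
Proof.
move=> Xx Xy; have pH := f_pd Xx; apply: mulmxB_bound => {}w.
have [->|zn] := eqVneq z 0; first by rewrite mul0mx dot0l hnorm0 mulr0 mul0r.
apply: le_trans (dnorm_dual _ _ pH) _; rewrite ler_wpM2r ?hnorm_ge0//.
rewrite -ler_pdivrMr ?hnorm_gt0// -lee_fin.
by apply: le_trans (f_holder Xx Xy); apply: ereal_sup_ubound; exists z.
Qed.

(** Testing against a fixed w reduces the vector remainder to a scalar function of t. The derivative
    of [F] is C t^nu minus the variation of the Hessian form, nonnegative by [holder_form] since x +
    t d lies at local distance t |d| from x. *)
Lemma holder_taylor x y w : X x -> X y ->
  dot (grad f y - grad f x - (y - x) *m hess f x) w <=
  L2 / (1 + nu) * hnorm (hess f x) (y - x) `^ (1 + nu) * hnorm (hess f x) w.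
Proof.
move=> Xx Xy; set d := y - x; set H := hess f x.
have pH := f_pd Xx; have psH := pd_psdmx pH.
set C := L2 * hnorm H d `^ (1 + nu) * hnorm H w.
have p0 : 0 < 1 + nu by rewrite addr_gt0.
pose F t := (C / (1 + nu)) * t `^ (1 + nu)
  - (dot (grad f (x + t *: d)) w - t * dot (d *m H) w).
have D t : 0 < t -> is_derive t 1 F
    (C * t `^ nu - (dot (d *m hess f (x + t *: d)) w - dot (d *m H) w)).
  move=> t0; apply: is_deriveB; last first.
    apply: is_deriveB; first exact: is_derive_grad_line.
    exact: is_derive_mulr_cst.
  apply: (is_derive_eq (is_deriveZ (C / (1 + nu)) (is_derive1_powR (1 + nu) t0))).
  rewrite [1 + nu - 1]addrC addKr /GRing.scale /=; field.
  by rewrite gt_eqF.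
have : F 0 <= F 1.
  apply: (ge0_derive_le01 (fun t h _ => D t h)) => [|t t0 t1].
    have K1 : {within `[0, 1], continuous (fun t => (C / (1 + nu)) * t `^ (1 + nu))}.
      move=> t; apply: cvgM; first exact: cvg_cst.
      exact: continuous_powR_itv.
    have K2 : continuous (fun t => dot (grad f (x + t *: d)) w - t * dot (d *m H) w).
      move=> t; apply: cvgB.
        exact: is_derive1_continuous (is_derive_grad_line x d w t).
      by apply: cvgM; [exact: cvg_id|exact: cvg_cst].
    move=> t; apply: cvgB; first exact: K1.
    exact: (continuous_subspaceT K2).
  have Xt := convex_setP X_convex Xx Xy (ltW t0) (ltW t1).
  have := holder_form d w Xx Xt; rewrite -/H hnormB sub_line -/d.
  rewrite (hnormZ _ psH (ltW t0)).
  rewrite (powRM _ (ltW t0) (hnorm_ge0 _ _)).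
  rewrite /C powRD; last by rewrite gt_eqF.
  rewrite powRr1 ?hnorm_ge0//.
  move: (hnorm H d) (hnorm H w) (hnorm H d `^ nu) (t `^ nu) => a b c e.
  generalize (dot (d *m hess f (x + t *: d)) w) (dot (d *m H) w) => a1 a2.
  by rewrite ler_norml; lra.
rewrite /F line0 line1 powR0 ?gt_eqF// powR1 !dotBl.
rewrite [L2 / _ * _]mulrAC [_ / _ * hnorm _ _]mulrAC -/C; lra.
Qed.

End Smoothness.

(** * Quadratic models and Hessian bounds *)

Section Continuity.
Context {R : realType} {n : nat}.
Implicit Types (x u v g : 'rV[R]_n) (A : 'M[R]_n).

Lemma cvg_dot (T : Type) (D : set_system T) (F G : T -> 'rV[R]_n) u v :
  Filter D ->
  (forall i, F t 0 i @[t --> D] --> u 0 i) ->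
  (forall i, G t 0 i @[t --> D] --> v 0 i) ->
  dot (F t) (G t) @[t --> D] --> dot u v.
Proof.
move=> FD cF cG; apply: cvg_big => [|i _]; first exact: add_continuous.
by apply: cvgM; [exact: cF|exact: cG].
Qed.

Lemma cvg_sub_coord (D : set_system 'rV[R]_n) x u i : Filter D -> D --> u ->
  (y - x) 0 i @[y --> D] --> (u - x) 0 i.
Proof.
move=> FD Du; rewrite !mxE; under eq_cvg do rewrite !mxE.
apply: cvgB; last exact: cvg_cst.
by apply: cvg_trans (@coord_continuous R 1 n 0 i u); exact: cvg_app.
Qed.

Lemma cvg_quad (D : set_system 'rV[R]_n) A x u : Filter D -> D --> u ->
  dot ((y - x) *m A) (y - x) @[y --> D] --> dot ((u - x) *m A) (u - x).
Proof.
move=> FD Du; apply: cvg_dot => i; last exact: cvg_sub_coord.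
rewrite mxE; under eq_cvg do rewrite mxE.
apply: cvg_big => [|j _]; first exact: add_continuous.
apply: cvgM; last exact: cvg_cst.
exact: cvg_sub_coord.
Qed.

Lemma quad_continuous A x :
  continuous (fun u => dot ((u - x) *m A) (u - x)).
Proof. by move=> u; apply: cvg_quad; [exact: nbhs_filter|exact: cvg_id]. Qed.

Lemma cvg_lin (D : set_system 'rV[R]_n) g x u : Filter D -> D --> u ->
  dot g (y - x) @[y --> D] --> dot g (u - x).
Proof.
by move=> FD Du; apply: cvg_dot => i; [exact: cvg_cst|exact: cvg_sub_coord].
Qed.

Lemma lin_continuous g x : continuous (fun u => dot g (u - x)).
Proof. by move=> u; apply: cvg_lin; [exact: nbhs_filter|exact: cvg_id]. Qed.

Lemma compact_min (X : set 'rV[R]_n) (F : 'rV[R]_n -> R) :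
  X !=set0 -> compact X -> continuous F ->
  exists2 c, X c & forall u, X u -> F c <= F u.
Proof.
move=> X0 cX cF.
have [c /set_mem Xc H] := EVT_min_rV X0 cX (continuous_subspaceT cF).
by exists c => // u Xu; apply: H; exact: mem_set.
Qed.

(** A real [sup] dominates its set only when that set is bounded above; the attained minimum of the
    linear form supplies the bound. *)
Lemma lin_gap_ub (X : set 'rV[R]_n) g u v : compact X -> X v ->
  dot g (u - v) <= lin_gap X g u.
Proof.
move=> cX Xv; have [c Xc H] := compact_min (ex_intro _ v Xv) cX (@lin_continuous g u).
apply: ub_le_sup; last by exists v.
exists (dot g (u - c)) => _ [w Xw <-].
by rewrite -[u - w]opprB -[u - c]opprB !dotNr lerN2 H.
Qed.

Lemma lin_gap_le (X : set 'rV[R]_n) g u c : X !=set0 ->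
  (forall v, X v -> dot g (u - v) <= c) -> lin_gap X g u <= c.
Proof.
move=> [v Xv] H; apply: ge_sup; first by exists (dot g (u - v)), v.
by move=> _ [w Xw <-]; exact: H.
Qed.

Lemma enorm_bounded (X : set 'rV[R]_n) : compact X ->
  exists2 M : R, 0 <= M & forall u v, X u -> X v -> enorm (u - v) <= M.
Proof.
move=> cX; have [[x Xx]|/set0P/negP] := pselect (X !=set0); last first.
  by rewrite negbK => /eqP ->; exists 0.
have cN : continuous (fun u => - dot ((u - x) *m 1%:M) (u - x)).
  move=> u; have C := @cvg_quad (nbhs u) 1%:M x u (nbhs_filter u) (@cvg_id _ _).
  exact: (cvgN C).
have [c Xc H] := compact_min (ex_intro _ x Xx) cX cN.
have B u : X u -> enorm (u - x) <= enorm (c - x).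
  move=> Xu; have := H _ Xu; rewrite lerN2 !mulmx1 => le.
  exact: ler_wsqrtr.
exists (enorm (c - x) + enorm (c - x)); first by rewrite addr_ge0 ?enorm_ge0.
move=> u v Xu Xv; apply: le_trans (enorm_tri u x v) _.
by rewrite lerD ?B// enormB B.
Qed.

(** If a < 0, then t = -a / (1 - a + |b|) lies in (0, 1) and satisfies t |b| < -a, so t a + t^2 b <
    0. *)
Lemma nonneg_slope (a b : R) :
  (forall t, 0 <= t -> t <= 1 -> 0 <= t * a + t ^+ 2 * b) -> 0 <= a.
Proof.
move=> H; rewrite leNgt; apply/negP => a0.
have d0 : 0 < 1 - a + `|b| by have := normr_ge0 b; lra.
have t0 : 0 < - a / (1 - a + `|b|) by rewrite divr_gt0//; lra.
have := H (- a / (1 - a + `|b|)) (ltW t0).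
rewrite ler_pdivrMr// mul1r => /(_ _).
have b0 := normr_ge0 b; have bb := ler_norm b.
set t := - a / _ in t0 *.
have te : t * (1 - a + `|b|) = - a by rewrite mulrVK// unitf_gt0.
have : t * (t * b) <= t * (t * `|b|) by rewrite !ler_pM2l.
have : 0 < t * (1 - a) by rewrite mulr_gt0//; lra.
move=> h1 h2 h3.
have : 0 <= t * a + t ^+ 2 * b by apply: h3; lra.
have : t * (t * `|b|) = t * (- a - t * (1 - a)) by congr (_ * _); lra.
have : 0 < t * (t * (1 - a)) by rewrite mulr_gt0.
by lra.
Qed.

End Continuity.

(** * The quadratic model: expansion, gradient and minimizer over X *)

Section Model.
Context {R : realType} {n : nat}.
Implicit Types (x u v w y : 'rV[R]_n).
Context (X : set 'rV[R]_n) (f : 'rV[R]_n -> R).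

Lemma Psi1E x u : psdmx (hess f x) ->
  Psi1 f x u = f x + dot (grad f x) (u - x) + 2^-1 * dot ((u - x) *m hess f x) (u - x).
Proof. by move=> pH; rewrite /Psi1 hnorm_sqr. Qed.

Lemma Psi1_expand x u v t : psdmx (hess f x) ->
  Psi1 f x (u + t *: v) = Psi1 f x u + t * dot (qgrad (grad f x) (hess f x) x u) v
    + t ^+ 2 * (2^-1 * dot (v *m hess f x) v).
Proof.
move=> pH; rewrite !Psi1E// [u + _ - x]addrAC quad_expand; last by case: pH.
by rewrite /qgrad [dot (_ + _) v]dotDl [dot _ (u - x + _)]dotDr dotZr; lra.
Qed.

(** By [Psi1_expand] the difference quotient along v is exactly <a, v> + h b, whose limit at h = 0
    is read off. *)
Lemma grad_Psi1 x u : psdmx (hess f x) ->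
  grad (Psi1 f x) u = qgrad (grad f x) (hess f x) x u.
Proof.
move=> pH; apply/rowP => i; rewrite gradE.
set v : 'rV[R]_n := delta_mx 0 i; set a := qgrad _ _ _ _.
have -> : a 0 i = dot a v.
  have vE j : v 0 j = (j == i)%:R by rewrite mxE eqxx.
  rewrite dot_sum (bigD1 i)//= vE eqxx mulr1 big1 ?addr0// => j ji.
  by rewrite vE (negPf ji) mulr0.
apply: cvg_lim => //; set b := 2^-1 * dot (v *m hess f x) v.
have C : (dot a v + h * b) @[h --> (0 : R)^'] --> dot a v.
  rewrite -[X in _ --> X]addr0 -[X in _ + X](mul0r b).
  apply: cvgD; first exact: cvg_cst.
  by apply: cvgM; [exact: cvg_within|exact: cvg_cst].
apply: cvg_trans C; apply: near_eq_cvg; near=> h.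
have hn : h != 0 by near: h; exact: nbhs_dnbhs_neq.
rewrite /= [_ + u]addrC Psi1_expand// -/a /GRing.scale /= -/b.
by field.
Unshelve. all: by end_near. Qed.

Lemma Psi1_continuous x : psdmx (hess f x) -> continuous (Psi1 f x).
Proof.
move=> pH; have -> : Psi1 f x = (fun u => f x + dot (grad f x) (u - x) +
    2^-1 * dot ((u - x) *m hess f x) (u - x)).
  by apply/funext => u; rewrite Psi1E.
move=> u; have C1 := @cvg_lin _ _ (nbhs u) (grad f x) x u (nbhs_filter u) (@cvg_id _ _).
have C2 := @cvg_quad _ _ (nbhs u) (hess f x) x u (nbhs_filter u) (@cvg_id _ _).
apply: (cvgD (cvgD _ C1) (cvgM _ C2)); exact: cvg_cst.
Qed.

Lemma Psi1_minimizer x : convex_set X -> compact X -> X !=set0 -> psdmx (hess f x) ->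
  exists2 xhat, X xhat &
    (forall u, X u -> Psi1 f x xhat <= Psi1 f x u) /\
    (forall v, X v -> 0 <= dot (qgrad (grad f x) (hess f x) x xhat) (v - xhat)).
Proof.
move=> vX cX X0 pH; have [c Xc H] := compact_min X0 cX (Psi1_continuous pH).
exists c => //; split=> // v Xv.
apply: (@nonneg_slope _ _ (2^-1 * dot ((v - c) *m hess f x) (v - c))) => t t0 t1.
have := H _ (convex_setP vX Xc Xv t0 t1); rewrite Psi1_expand//; lra.
Qed.

End Model.

(** * Uniform Hessian bounds from the Hoelder condition and compactness *)

Section HessBounds.
Context {R : realType} {n : nat}.
Context (X : set 'rV[R]_n) (f : 'rV[R]_n -> R) (nu L2 : R).
Hypotheses (f_pd : forall x, X x -> pdmx (hess f x)).
Hypotheses (nu_gt0 : 0 < nu) (L2_gt0 : 0 < L2) (f_holder : holder2 X f L2 nu).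

Lemma hess_half_close (x y z : 'rV[R]_n) : X x -> X y ->
  L2 * hnorm (hess f x) (x - y) `^ nu <= 2^-1 ->
  2^-1 * dot (z *m hess f x) z <= dot (z *m hess f y) z <= 2 * dot (z *m hess f x) z.
Proof.
move=> Xx Xy h; have pH := pd_psdmx (f_pd Xx).
have := holder_form f_pd f_holder z z Xx Xy.
rewrite -[_ * hnorm _ z * _]mulrA -expr2 (hnorm_sqr _ pH) ler_norml.
have := proj2 pH z; generalize (dot (z *m hess f x) z) (dot (z *m hess f y) z) => a b.
move: h; move: (_ * _) => c h a0.
have : c * a <= 2^-1 * a by rewrite ler_wpM2r.
by move=> *; apply/andP; split; lra.
Qed.

(** Near each x the Hoelder condition makes the Hessian forms comparable to the one at x, itself
    comparable to the Euclidean form; compactness makes the constant uniform. One c serves both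
    sides, with mu = 1/c and L = c. *)
Lemma hess_bounds_exist : compact X ->
  exists mu L : R, [/\ 0 < mu, 0 < L & hess_bounds X f mu L].
Proof.
move=> /compact_near_coveringP cX.
pose P (c : R) (y : 'rV[R]_n) := X y -> forall z,
  dot z z <= c * dot (z *m hess f y) z /\ dot (z *m hess f y) z <= c * dot z z.
have : \forall c \near +oo, X `<=` P c.
  apply: cX => x Xx.
  have pH := f_pd Xx; have psH := pd_psdmx pH.
  have [c1 c1_gt0 h1] := pdmx_lower_bound pH.
  have [c2 c2_gt0 h2] := mx_upper_bound (hess f x).
  (* The radius e solves L2 e^nu = 1/2, the closeness required by [hess_half_close]. *)
  set e := ((2 * L2)^-1 `^ nu^-1).
  have LL : 0 < (2 * L2)^-1 by rewrite invr_gt0 mulr_gt0.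
  have e0 : 0 < e by rewrite powR_gt0.
  have ec : e `^ nu = (2 * L2)^-1.
    rewrite /e -powRrM mulVf ?gt_eqF// powRr1 ?ltW//.
  have C := @quad_continuous _ _ (hess f x) x x.
  have nC : \forall y \near x, dot ((y - x) *m hess f x) (y - x) <= e ^+ 2.
    apply: (cvgr_le _ C); rewrite subrr dot0r exprn_gt0//.
  exists ([set y | dot ((y - x) *m hess f x) (y - x) <= e ^+ 2],
      [set c | 2 / c1 <= c /\ 2 * c2 <= c]) => /=.
    split=> //; near=> c; split; near: c; apply: nbhs_pinfty_ge; exact: num_real.
  move=> [y c] /= [ny [cc cd]] Xy z.
  have hy : L2 * hnorm (hess f x) (x - y) `^ nu <= 2^-1.
    have le : hnorm (hess f x) (x - y) <= e.
      by rewrite hnormB -[e]ger0_norm ?(ltW e0)// -sqrtr_sqr; exact: ler_wsqrtr.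
    apply: (@le_trans _ _ (L2 * e `^ nu)).
      by rewrite ler_pM2l// ge0_ler_powR ?nnegrE ?hnorm_ge0 ?(ltW e0)// ltW.
    rewrite ec invfM mulrCA divff ?gt_eqF// mulr1; exact: lexx.
  have := hess_half_close z Xx Xy hy.
  have := dot_ge0 z; have := h1 z; have := h2 z; have := proj2 psH z.
  generalize (dot (z *m hess f x) z) (dot (z *m hess f y) z) (dot z z).
  move=> a b s a0 u2 u1 s0 /andP[l1 l2]; split.
    apply: (@le_trans _ _ (2 / c1 * b)); last first.
      by rewrite ler_wpM2r//; lra.
    by rewrite mulrAC ler_pdivlMr// mulrC; lra.
  apply: le_trans l2 _; apply: (@le_trans _ _ (2 * c2 * s)); first by lra.
  by rewrite ler_wpM2r.
move=> H; have [c [c0 Hc]] : exists c : R, 0 < c /\ X `<=` P c.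
  near (pinfty_nbhs R) => c; exists c; split; near: c => //.
  by apply: nbhs_pinfty_gt; rewrite num_real.
exists c^-1, c; split; rewrite ?invr_gt0// => x Xx.
have sH := proj1 (f_pd Xx).
split; split => [|z].
- by rewrite raddfB /= tr_scalar_mx sH.
- have [le _] := Hc _ Xx Xx z.
  by rewrite mulmxBr dotBl mul_mx_scalar dotZl subr_ge0 mulrC ler_pdivrMr// mulrC.
- by rewrite raddfB /= tr_scalar_mx sH.
- have [_ le] := Hc _ Xx Xx z.
  by rewrite mulmxBr dotBl mul_mx_scalar dotZl subr_ge0.
Unshelve. all: by end_near. Qed.

Lemma local_diameter_ub (L : R) x y : compact X -> 0 <= L ->
  (forall z, X z -> loewner_le (hess f z) L%:M) -> X x -> X y ->
  hnorm (hess f x) (x - y) <= local_diameter X f.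
Proof.
move=> cX L0 hL Xx Xy; have [M M0 hM] := enorm_bounded cX.
apply: ub_le_sup; last by exists x, y.
exists (Num.sqrt L * M) => _ [u [v [Xu Xv ->]]].
apply: le_trans (hnorm_le_enorm _ L0 (hL _ Xu)) _.
by rewrite ler_wpM2l ?sqrtr_ge0// hM.
Qed.

End HessBounds.

(** * Inner procedures *)

Section VertexRepresentation.
Context {R : realType} {n : nat}.
Implicit Types (X : set 'rV[R]_n) (u v w : 'rV[R]_n) (lam : weights R n).
Implicit Types (s : seq 'rV[R]_n).

(** The list s need only contain the support of the weights, so a vertex whose weight drops to 0 may
    stay in it. *)
Definition vertex_rep X u lam := exists s,
  [/\ uniq s /\ {in s, forall w, X w}, forall w, w \notin s -> lam w = 0,
      forall w, 0 <= lam w, \sum_(w <- s) lam w = 1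
    & \sum_(w <- s) lam w *: w = u].

(** Dividing by the total weight spares renormalizing the tail in the induction: the point lies on
    the segment from a to the barycenter of the tail, at parameter T / (c a + T). If T = 0 only a
    remains. *)
Lemma convex_combination X s (c : 'rV[R]_n -> R) :
  convex_set X -> {in s, forall w, X w} -> (forall w, 0 <= c w) ->
  0 < \sum_(w <- s) c w ->
  X ((\sum_(w <- s) c w)^-1 *: \sum_(w <- s) c w *: w).
Proof.
move=> cX; elim: s => [|a s IH] Xs c0; first by rewrite big_nil ltxx.
have Xa : X a by apply: Xs; rewrite mem_head.
have {}IH := IH (fun w ws => Xs w (@mem_behead _ (a :: s) w ws)) c0.
rewrite !big_cons; set T := \sum_(w <- s) c w in IH *.
have T0 : 0 <= T by exact: sumr_ge0.
have [Tz|Tn] := eqVneq T 0.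
  rewrite Tz addr0 => ca; rewrite big_seq big1 ?addr0.
    by rewrite scalerA mulVf ?gt_eqF// scale1r.
  move=> w ws; have /allP/(_ w ws)/eqP -> : all (fun w => c w == 0) s.
    by rewrite -(eq_all (fun w => implyTb _)) -psumr_eq0 // -/T Tz.
  by rewrite scale0r.
move=> S0; have Tp : 0 < T by rewrite lt_def Tn.
have := convex_setP (t := T / (c a + T)) cX Xa (IH Tp).
rewrite ler_pdivrMr// mul1r lerDr c0 divr_ge0 ?(ltW S0)// => /(_ isT isT).
congr (X _); rewrite scalerBr scalerA -[_ / _ / T]mulrAC divff// div1r.
rewrite scalerDr addrCA [RHS]addrC; congr (_ + _).
rewrite scalerA -[X in X - _]scale1r -scalerBl; congr (_ *: _).
by field; rewrite gt_eqF.
Qed.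

Lemma vertex_rep_mem X u lam : convex_set X -> vertex_rep X u lam -> X u.
Proof.
move=> cX [s [[_ Xs] _ l0 l1 <-]].
by have := convex_combination cX Xs l0; rewrite l1 ltr01 invr1 scale1r; apply.
Qed.

Lemma sum_indicator (V : lmodType R) s a (F : 'rV[R]_n -> V) : uniq s -> a \in s ->
  \sum_(w <- s) (w == a)%:R *: F w = F a.
Proof.
move=> us ais; rewrite (bigD1_seq a)//= eqxx scale1r big1 ?addr0// => w wa.
by rewrite (negPf wa) scale0r.
Qed.

Lemma vertex_rep1 X v lam : X v -> (forall w, lam w = (w == v)%:R) ->
  vertex_rep X v lam.
Proof.
move=> Xv lE; exists [:: v]; split=> [|w|w||].
- by split=> // w; rewrite inE => /eqP ->.
- by rewrite inE lE => /negPf ->.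
- by rewrite lE ler0n.
- by rewrite big_seq1 lE eqxx.
- by rewrite big_seq1 lE eqxx scale1r.
Qed.

(* An FW step has b >= 0; an away step of length gamma is the case b = - gamma. *)
Lemma vertex_rep_update X u lam lam' v (b : R) : vertex_rep X u lam -> X v ->
  (forall w, lam' w = (1 - b) * lam w + b * (w == v)%:R) ->
  (forall w, 0 <= lam' w) ->
  vertex_rep X ((1 - b) *: u + b *: v) lam'.
Proof.
move=> [s [[us Xs] s0 l0 l1 lu]] Xv lE l'0.
have key s' : uniq s' -> {in s', forall w, X w} -> (forall w, w \notin s' -> lam w = 0) ->
    \sum_(w <- s') lam w = 1 -> \sum_(w <- s') lam w *: w = u -> v \in s' ->
    vertex_rep X ((1 - b) *: u + b *: v) lam'.
  move=> us' Xs' s'0 l1' lu' vs; exists s'; split=> // [w ws||].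
  - rewrite lE s'0// (_ : w == v = false) ?mulr0 ?addr0//.
    by apply: contraNF ws => /eqP ->.
  - under eq_bigr do rewrite lE.
    rewrite big_split /= -!mulr_sumr l1'.
    have := sum_indicator (fun=> (1 : R^o)) us' vs.
    under eq_bigr do rewrite /GRing.scale /= mulr1.
    by move=> ->; lra.
  - under eq_bigr do rewrite lE scalerDl -!scalerA.
    by rewrite big_split /= -!scaler_sumr lu' sum_indicator.
have [vs|vs] := boolP (v \in s); first exact: (key s).
(* A vertex outside s is added with its current weight 0, which changes neither sum. *)
apply: (key (v :: s)); rewrite ?mem_head//= ?vs ?big_cons ?s0// ?scale0r ?add0r//.
  by move=> w; rewrite inE => /orP[/eqP ->|/Xs].
by move=> w; rewrite inE negb_or => /andP[_ /s0].
Qed.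

End VertexRepresentation.

(** * What a run of FW or AFW guarantees at the returned point *)

Section InnerProcedures.
Context {R : realType} {n : nat}.
Implicit Types (X : set 'rV[R]_n) (u v w d h x z : 'rV[R]_n) (lam : weights R n).

(** The model without its value at x, for any H: it covers both the scaled Hessians of the residual
    phase and the full Newton step. *)
Definition qmodel (H : 'M[R]_n) h x u := dot h (u - x) + 2^-1 * dot ((u - x) *m H) (u - x).

Lemma qmodel0 H h x : qmodel H h x x = 0.
Proof. by rewrite /qmodel subrr !dot0r mulr0 addr0. Qed.

Lemma qmodel_step H h x u d a : H^T = H ->
  qmodel H h x (u - a *: d) = qmodel H h x u - a * dot (qgrad h H x u) d
    + a ^+ 2 / 2 * dot (d *m H) d.
Proof.
move=> sH; rewrite /qmodel [u - _ - x]addrAC -scaleNr quad_expand//.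
by rewrite /qgrad [dot (_ + _) d]dotDl [dot _ (u - x + _)]dotDr dotZr; lra.
Qed.

(** The change of the model is -a <G, d> + a^2 N / 2 with a N <= <G, d>, hence at most -a^2 N / 2.
    Truncated line searches are therefore allowed. *)
Lemma qmodel_descent H h x u d a : psdmx H -> 0 <= a ->
  a * dot (d *m H) d <= dot (qgrad h H x u) d ->
  qmodel H h x (u - a *: d) <= qmodel H h x u.
Proof.
move=> [sH pH] a0 le; rewrite qmodel_step//.
have := mulr_ge0 a0 (mulr_ge0 a0 (pH d)); have := ler_wpM2l a0 le.
by generalize (dot (qgrad h H x u) d) (dot (d *m H) d) => p r; lra.
Qed.

Lemma line_search_step (g c N : R) : 0 <= g -> 0 <= c -> 0 <= N ->
  let a := Num.min g (c / N) in [/\ 0 <= a, a <= g & a * N <= c].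
Proof.
move=> g0 c0 N0 /=; split.
- by rewrite le_min g0 divr_ge0.
- by rewrite ge_min lexx.
(* For N = 0 the claim a N <= c is just 0 <= c. *)
- have [->|Nn] := eqVneq N 0; first by rewrite mulr0.
  have : Num.min g (c / N) <= c / N by rewrite ge_min lexx orbT.
  by rewrite ler_pdivlMr// lt_def Nn.
Qed.

Lemma FW_step_mem X H h x u v : convex_set X -> psdmx H -> X u ->
  lin_argmin X (qgrad h H x u) v ->
  let a := Num.min 1 (dot (qgrad h H x u) (u - v) / hnorm H (v - u) ^+ 2) in
  let u' := (1 - a) *: u + a *: v in
  [/\ 0 <= a, a <= 1, X u' & qmodel H h x u' <= qmodel H h x u].
Proof.
move=> cX pH Xu [Xv vmin]; set G := qgrad h H x u.
have g0 : 0 <= dot G (u - v) by rewrite dotBr subr_ge0 vmin.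
rewrite hnormB hnorm_sqr//.
have [] := line_search_step ler01 g0 (proj2 pH (u - v)).
set a := Num.min _ _ => a0 a1 aN /=.
have uE : (1 - a) *: u + a *: v = u - a *: (u - v).
  by rewrite scalerBl scale1r scalerBr opprB addrA addrAC.
split=> //; last by rewrite uE; exact: qmodel_descent.
by rewrite uE -scalerN opprB; exact: convex_setP.
Qed.

Lemma FW_returns_spec X H h x stop z : convex_set X -> psdmx H -> X x ->
  FW_returns X h H x stop z ->
  [/\ X z, qmodel H h x z <= 0 &
    exists2 v, lin_argmin X (qgrad h H x z) v & stop z v].
Proof.
move=> cX pH Xx [us [vs [T [u0 vmin step stopT ->]]]].
suff inv : forall t, (t <= T)%N -> X (us t) /\ qmodel H h x (us t) <= 0.
  by have [? ?] := inv T (leqnn T); split=> //; exists (vs T) => //; exact: vmin.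
elim=> [_|t IH tT]; first by rewrite u0 qmodel0.
have [Xu uq] := IH (ltnW tT); have [_ ->] := step t tT.
have [_ _ Xu' le] := FW_step_mem cX pH Xu (vmin t (ltnW tT)).
by split=> //; exact: le_trans le uq.
Qed.

(** An away step moves away from a vertex, so feasibility is deduced from the new weights: the cap
    on the step keeps the weight of [vA] nonnegative, and the others only grow. *)
Lemma AFW_step_spec X H h x u lam vF vA u' lam' :
  convex_set X -> psdmx H -> vertex_rep X u lam ->
  lin_argmin X (qgrad h H x u) vF -> vA \in finsupp lam ->
  AFW_step (qgrad h H x u) H u lam vF vA u' lam' ->
  vertex_rep X u' lam' /\ qmodel H h x u' <= qmodel H h x u.
Proof.
move=> cX pH rep vmin vAs; have Xu := vertex_rep_mem cX rep.
have [Xv vle] := vmin; rewrite /AFW_step; set G := qgrad h H x u.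
have g0 : 0 <= dot G (u - vF) by rewrite dotBr subr_ge0 vle.
case: ifPn => [_ [-> lE]|].
  have [] := FW_step_mem cX pH Xu vmin; rewrite -/G hnormB in lE *.
  set a := Num.min _ _ => a0 a1 _ le.
  have uE : (1 - a) *: u + a *: vF = u - a *: (u - vF).
    by rewrite scalerBl scale1r scalerBr opprB addrA addrAC.
  rewrite -uE; split=> //; apply: (vertex_rep_update rep Xv lE) => w.
  have [_ [_ _ l0 _ _]] := rep; rewrite lE.
  by rewrite addr_ge0 ?mulr_ge0 ?ler0n ?subr_ge0.
rewrite -ltNge => /ltW/(le_trans g0) gA [-> lE].
have [s [[us Xs] s0 l0 l1 _]] := rep.
have lA : lam vA != 0 by rewrite -mem_finsupp.
have vA_s : vA \in s by apply: contraNT lA => /s0 ->.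
have lA1 : lam vA <= 1.
  by rewrite -l1 (bigD1_seq vA)//= lerDl sumr_ge0.
have gm : 0 <= lam vA / (1 - lam vA) by rewrite divr_ge0 ?subr_ge0.
rewrite hnorm_sqr// in lE *.
have [] := line_search_step gm gA (proj2 pH (vA - u)).
move: lE; set a := Num.min _ _ => lE a0 a1 aN.
have uE : u - a *: (vA - u) = (1 - - a) *: u + - a *: vA.
  by rewrite opprK scalerDl scale1r scalerBr opprB scaleNr addrA.
split; last exact: qmodel_descent.
rewrite uE; apply: vertex_rep_update rep (Xs _ vA_s) _ _ => w.
  by rewrite lE opprK mulNr.
rewrite lE; have [->|_] := eqVneq w vA; last first.
  by rewrite mulr0 subr0 mulr_ge0// addr_ge0.
(* If [vA] carries all the weight, its new weight is (1 + a) - a = 1 for every a. *)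
rewrite mulr1; have [e1|ln] := eqVneq (lam vA) 1.
  by rewrite e1 mulr1 addrK.
have lt : 0 < 1 - lam vA by rewrite subr_gt0 lt_neqAle ln.
by move: a1; rewrite ler_pdivlMr//; lra.
Qed.

Lemma AFW_returns_spec X H h x lam stop z lamz :
  convex_set X -> psdmx H -> vertex_rep X x lam ->
  AFW_returns X h H x lam stop z lamz ->
  [/\ vertex_rep X z lamz, qmodel H h x z <= 0 &
    exists2 v, lin_argmin X (qgrad h H x z) v & stop z v].
Proof.
move=> cX pH rep [us [vF [vA [lams [T [[u0 lam0] vmin step stopT [-> ->]]]]]]].
suff inv : forall t, (t <= T)%N ->
    vertex_rep X (us t) (lams t) /\ qmodel H h x (us t) <= 0.
  have [? ?] := inv T (leqnn T); split=> //; exists (vF T) => //.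
  by have [] := vmin T (leqnn T).
elim=> [_|t IH tT]; first by rewrite u0 lam0 qmodel0.
have [Xu uq] := IH (ltnW tT); have [_ vAs _ st] := step t tT.
have [vm _] := vmin t (ltnW tT).
have [rep' le] := AFW_step_spec cX pH Xu vm vAs st.
by split=> //; exact: le_trans le uq.
Qed.

Lemma inner_returns_spec m X H h x lam stop z lamz :
  convex_set X -> psdmx H -> X x -> (m = AFW -> vertex_rep X x lam) ->
  inner_returns m X h H x lam stop z lamz ->
  [/\ X z, m = AFW -> vertex_rep X z lamz, qmodel H h x z <= 0 &
    exists2 v, lin_argmin X (qgrad h H x z) v & stop z v].
Proof.
case: m => cX pH Xx rep /=.
  by move=> /(FW_returns_spec cX pH Xx)[].
move=> /(AFW_returns_spec cX pH (rep erefl))[rep' q v].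
by split=> //; exact: vertex_rep_mem cX rep'.
Qed.

End InnerProcedures.

(** * Residual phase *)

Section GlobalPhase.
Context {R : realType} {n : nat}.
Implicit Types (x y v : 'rV[R]_n) (st : state (R := R) (n := n)).
Context (X : set 'rV[R]_n) (f : 'rV[R]_n -> R) (m : inner_kind).
Context (q L2 rho omega tau c2 mu L : R).
Hypotheses (X_neq0 : X !=set0) (X_compact : compact X) (X_convex : convex_set X).
Hypotheses (f_diff2 : twice_differentiable f).
Hypothesis f_pd : forall x, X x -> pdmx (hess f x).
Hypotheses (mu_gt0 : 0 < mu) (L_gt0 : 0 < L) (f_bounds : hess_bounds X f mu L).
Hypotheses (rho_gt0 : 0 < rho) (rho_lt1 : rho < 1) (omega_gt0 : 0 < omega).
Hypotheses (tau_gt1 : 1 < tau) (c2_gt0 : 0 < c2) (q_gt2 : 2 < q) (L2_gt0 : 0 < L2).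

Let B := B_const q L2 omega rho.
Let beta := (q - 2) / (q - 1).
Let p := q / (q - 1).

(** This is Delta_k, whereas [st_Delta st] still holds Delta_{k-1}. *)
Definition st_residual st :=
  Num.max (dnorm (hess f (st_x st)) (grad f (st_x st) + st_s st)) (rho * st_Delta st).

(** The last clause remembers the previous inner stopping test: -s_{k-1} is the gradient at x_k of
    the model just minimized. *)
Definition st_inv st :=
  [/\ X (st_x st), m = AFW -> vertex_rep X (st_x st) (st_lam st), 0 <= st_Delta st,
      0 < st_thbar st &
      forall v, X v -> dot (- st_s st) (st_x st - v) <= omega * st_Delta st ^+ 2].

Lemma B_gt0 : 0 < B.
Proof.
rewrite mulr_gt0// powR_gt0//; first by rewrite mulr_gt0.
by rewrite /kappa divr_gt0// ltr_wpDr// sqrtr_ge0.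
Qed.

Lemma st_residual_ge0 st : 0 <= st_residual st.
Proof. by rewrite le_max dnorm_ge0. Qed.

(** Since -s' is the model gradient at the accepted point, the inner stopping test bounds its gap.
    Since w is (1 + theta) times the Hessian applied to x - x', the factor 1 / alpha = 1 + theta
    cancels from the acceptance test. Positivity of the residual gives theta > 0. *)
Lemma residual_step_spec st st' : st_inv st -> 0 < st_residual st ->
  residual_step m X f q L2 rho omega tau c2 st st' ->
  let D := st_residual st in
  exists2 th, 0 < th /\ th <= B * D `^ beta &
  [/\ X (st_x st'), m = AFW -> vertex_rep X (st_x st') (st_lam st'),
      st_Delta st' = D /\ 0 < st_thbar st',
      forall v, X v -> dot (- st_s st') (st_x st' - v) <=
        omega * D ^+ 2 / (1 + B * D `^ beta)
    & c2 / th * dnorm (hess f (st_x st)) (grad f (st_x st') + st_s st') ^+ 2 <=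
      dot (grad f (st_x st') + st_s st') (st_x st - st_x st')].
Proof.
move=> [Xx rep De0 th0 sgap] D0 [j [y [lamy [ret _ acc ->]]]] /=.
rewrite -/(st_residual st) -/B -/beta in ret acc *.
set D := st_residual st in D0 ret acc *; set g := grad f (st_x st) in ret acc *.
set H := hess f (st_x st) in ret acc *.
set th := Num.min _ _ in acc *.
have pH : pdmx H by exact: f_pd.
have tau0 : 0 < tau by exact: lt_trans tau_gt1.
have thp : 0 < th.
  rewrite lt_min; apply/andP; split; apply: mulr_gt0 => //.
  - exact: exprn_gt0.
  - exact: B_gt0.
  - exact: powR_gt0.
have thB : th <= B * D `^ beta by rewrite ge_min lexx orbT.
have ap : 0 < 1 + th by rewrite addr_gt0.
have aE : (1 / (1 + th))^-1 = 1 + th by rewrite div1r invrK.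
have := ret j (leqnn j); rewrite -/th aE.
move=> /(inner_returns_spec X_convex (psdmxZ (ltW ap) (pd_psdmx pH)) Xx rep).
move: acc; rewrite aE; set z := y j; set s' := - g - _; set Ha := _ *: H in s' *.
move=> acc [Xz rep' _ [v [Xv vmin] stopv]].
exists th => //; split=> // [|w Xw|].
- by split=> //; rewrite divr_gt0.
- have -> : - s' = qgrad g Ha (st_x st) z by rewrite /s' opprB opprK addrC.
  apply: le_trans stopv; rewrite !dotBr lerD2l lerN2.
  exact: vmin.
- move: acc; have -> : (g + s') *m invmx H = (1 + th) *: (st_x st - z).
    rewrite /s' addrA subrr add0r /Ha -scalemxAr -scaleNr -scalemxAl mulmxK ?pdmx_unit//.
    by rewrite scaleNr -scalerN opprB.
  rewrite dotZr; set r := dnorm _ _ ^+ 2; set e := dot _ _ => acc.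
  rewrite -(ler_pM2l ap); apply: le_trans acc.
  rewrite le_eqVlt; apply/orP; left; apply/eqP; field.
  by rewrite !gt_eqF.
Qed.

(* If D' = rho D, the decrease comes from the drop of the second term of V;
   otherwise D' = r and it comes from the acceptance test, which dominates since
   r^beta >= (rho D)^beta >= rho^2 D^beta. *)
Lemma lyapunov_scalar (c D D' r th y y' V V' : R) : 0 < c -> 0 < D -> 0 <= r ->
  0 < th -> th <= B * D `^ beta -> D' = Num.max r (rho * D) ->
  V = y + c * rho ^+ 2 / B * D `^ p -> V' = y' + c * rho ^+ 2 / B * D' `^ p ->
  c / th * r ^+ 2 - omega * D ^+ 2 / (1 + B * D `^ beta) <= y - y' ->
  (c * rho ^+ 2 * (1 - rho `^ p) - omega) / B * D `^ p <= V - V'.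
Proof.
move=> c0 D0 r0 th0 thB -> -> -> hF; have B0 := B_gt0.
have q1 : 0 < q - 1 by move: q_gt2; lra.
have b0 : 0 < beta by rewrite divr_gt0// subr_gt0.
have b1 : beta <= 2 by rewrite ler_pdivrMr//; move: q_gt2; lra.
have p0 : 0 < p by rewrite divr_gt0// (lt_trans _ q_gt2).
(* This splits D^2 as D^beta D^p, so the tolerance omega D^2 / (1 + B D^beta) is at most (omega / B)
   D^p. *)
have bp : beta + p = 2 by rewrite /beta /p; field; rewrite gt_eqF.
have pow2 (t : R) : 0 < t -> t `^ beta * t `^ p = t ^+ 2.
  by move=> t0; rewrite -powRD ?bp ?powR_mulrn ?ltW// gt_eqF ?implybT.
have T0 : 0 < D `^ beta by rewrite powR_gt0.
have E0 : 0 < D `^ p by rewrite powR_gt0.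
have hT : 0 < B * D `^ beta by rewrite mulr_gt0.
have h1 : c / (B * D `^ beta) * r ^+ 2 - omega / B * D `^ p <= y - y'.
  apply: le_trans hF; apply: lerB.
    by rewrite ler_wpM2r ?sqr_ge0// ler_wpM2l ?(ltW c0)// lef_pV2.
  rewrite -(pow2 _ D0) ler_pdivrMr ?addr_gt0//.
  rewrite [leRHS](_ : _ = omega * (D `^ beta * D `^ p) + omega / B * D `^ p).
    by rewrite lerDl mulr_ge0 ?divr_ge0 ?ltW.
  by field; rewrite gt_eqF.
(* Multiplied by c rho^2 / B, the last term becomes c r^2 / (B D^beta), which [h1] pays for. *)
have key : Num.max r (rho * D) `^ p <=
    rho `^ p * D `^ p + r ^+ 2 / (rho ^+ 2 * D `^ beta).
  have [rD|Dr] := leP r (rho * D).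
    rewrite powRM ?(ltW rho_gt0) ?(ltW D0)// lerDl; apply: divr_ge0; first exact: sqr_ge0.
    by apply: mulr_ge0; [exact: sqr_ge0|exact: ltW].
  have rp : 0 < r by apply: lt_trans Dr; rewrite mulr_gt0.
  apply: ler_wpDl; first by rewrite mulr_ge0 ?powR_ge0.
  rewrite ler_pdivlMr ?mulr_gt0 ?exprn_gt0// -(pow2 _ rp) [leRHS]mulrC ler_wpM2l ?powR_ge0//.
  apply: (@le_trans _ _ ((rho * D) `^ beta)); last first.
    apply: ge0_ler_powR; rewrite ?nnegrE; [exact: ltW| |exact: ltW|exact: ltW].
    exact/ltW/mulr_gt0.
  rewrite powRM ?(ltW rho_gt0) ?(ltW D0)// ler_wpM2r ?powR_ge0//.
  rewrite -powR_mulrn ?(ltW rho_gt0)//.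
  by apply: ger_powR; rewrite // rho_gt0 ltW.
have k0 : 0 <= c * rho ^+ 2 / B.
  exact: divr_ge0 (mulr_ge0 (ltW c0) (sqr_ge0 _)) (ltW B0).
have := ler_wpM2l k0 key.
rewrite [X in _ <= X -> _](_ : _ = c * rho ^+ 2 / B * rho `^ p * D `^ p +
    c / (B * D `^ beta) * r ^+ 2); last first.
  by field; rewrite !gt_eqF.
by move: h1; rewrite mulrBl; lra.
Qed.

(** The gradient is the residual minus s_{k-1}. Duality and the local diameter handle the residual;
    the invariant handles the rest, with Delta_{k-1} <= Delta_k / rho. *)
Lemma st_gap_le st v : st_inv st -> X v ->
  dot (grad f (st_x st)) (st_x st - v) <=
  st_residual st * (local_diameter X f + omega / rho ^+ 2 * st_residual st).
Proof.
move=> [Xx _ De0 _ sgap] Xv.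
have e : grad f (st_x st) = (grad f (st_x st) + st_s st) + - st_s st by rewrite addrK.
rewrite e dotDl mulrDr lerD//.
  apply: le_trans (dnorm_dual _ _ (f_pd Xx)) _.
  apply: ler_pM; rewrite ?dnorm_ge0 ?hnorm_ge0//; first by rewrite le_max lexx.
  by apply: (local_diameter_ub X_compact (ltW L_gt0)) => // z /f_bounds[].
apply: le_trans (sgap _ Xv) _.
have le : rho * st_Delta st <= st_residual st by rewrite le_max lexx orbT.
rewrite [leLHS](_ : _ = omega / rho ^+ 2 * (rho * st_Delta st) ^+ 2); last first.
  by field; rewrite gt_eqF.
rewrite [leRHS]mulrC -[leRHS]mulrA -expr2; apply: ler_wpM2l.
  by rewrite divr_ge0 ?sqr_ge0 ?ltW.
by rewrite lerXn2r// nnegrE ?st_residual_ge0// mulr_ge0// ltW.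
Qed.

Lemma st_residual_gt0 st eps : st_inv st -> 0 < eps ->
  ~ fw_gap X f (st_x st) <= eps -> 0 < st_residual st.
Proof.
move=> inv eps0 ng; rewrite lt_def st_residual_ge0 andbT; apply/eqP => r0; apply: ng.
rewrite /fw_gap; apply: (lin_gap_le X_neq0) => v Xv.
by apply: le_trans (st_gap_le inv Xv) _; rewrite r0 mul0r ltW.
Qed.

Lemma init_state_inv thbar0 st : 0 < thbar0 -> init_state m X thbar0 st -> st_inv st.
Proof.
move=> t0 [Xx0 s0 De0 tE initA].
split; rewrite ?s0 ?De0 ?tE//; last by move=> v _; rewrite oppr0 dot0l expr0n mulr0.
by move=> /initA[_ _ lE]; exact: vertex_rep1.
Qed.

Lemma residual_step_inv st st' : st_inv st -> 0 < st_residual st ->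
  residual_step m X f q L2 rho omega tau c2 st st' -> st_inv st'.
Proof.
move=> inv D0 step; have [th _ [Xy rep [De t0] g _]] := residual_step_spec inv D0 step.
split=> // [|v Xv]; rewrite De; first exact: ltW.
apply: le_trans (g v Xv) _.
have B0 : 0 <= B * st_residual st `^ beta.
  by rewrite mulr_ge0 ?powR_ge0 ?(ltW B_gt0).
rewrite ler_pdivrMr ?ltr_pwDl// ler_peMr ?lerDl//.
by rewrite mulr_ge0 ?sqr_ge0 ?ltW.
Qed.

(** The factor mu / L is the cost of passing, through the Euclidean norm, from the dual norm at x_k
    used by the acceptance test to the one at x_{k+1} used in Delta_{k+1}. *)
Let c := c2 * mu / L.

Definition lyapunov st :=
  f (st_x st) + c * rho ^+ 2 / B * st_residual st `^ p.

Lemma descent_scalar (u w a b F F' Q : R) : 0 <= Q -> F' + a + Q <= F ->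
  u <= a + b -> b <= w -> u - w <= F - F'.
Proof. by move=> *; lra. Qed.

Lemma telescope_le (a b u v w : R) : a <= u - v -> b <= v - w -> a + b <= u - w.
Proof. by move=> *; lra. Qed.

(** Strong convexity at x' bounds f(x) - f(x') below by <grad f(x'), x - x'>, that is <r, x - x'>
    minus <-s', x' - x>. The acceptance test controls the first term and the inner stopping test,
    taken at v = x, the second. *)
Lemma residual_step_decrease st st' : st_inv st -> 0 < st_residual st ->
  residual_step m X f q L2 rho omega tau c2 st st' ->
  (c * rho ^+ 2 * (1 - rho `^ p) - omega) / B * st_residual st `^ p <=
  lyapunov st - lyapunov st'.
Proof.
move=> inv D0 step; have [Xx _ _ _ _] := inv.
have [th [th0 thB] [Xy _ [De _] gap acc]] := residual_step_spec inv D0 step.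
have c0 : 0 < c by rewrite divr_gt0 ?mulr_gt0.
set r := grad f (st_x st') + st_s st' in acc *.
set rn := dnorm (hess f (st_x st')) r.
have rn0 : 0 <= rn by exact: dnorm_ge0.
have E : st_residual st' = Num.max rn (rho * st_residual st).
  exact: (congr1 (fun d => Num.max rn (rho * d)) De).
apply: (lyapunov_scalar c0 D0 rn0 th0 thB E erefl erefl).
have [mux _] : loewner_le mu%:M (hess f (st_x st')) /\ _ := f_bounds Xy.
have [_ Lx] : _ /\ loewner_le (hess f (st_x st)) L%:M := f_bounds Xx.
have m1 := dnorm_le_enorm r mu_gt0 mux (f_pd Xy).
have m2 := enorm_le_dnorm r L_gt0 Lx (f_pd Xx).
have e1 : c / th * rn ^+ 2 <= dot r (st_x st - st_x st').
  apply: le_trans acc; rewrite /c.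
  rewrite (_ : _ * rn ^+ 2 = c2 / (th * L) * (mu * rn ^+ 2)); last first.
    by field; rewrite !gt_eqF.
  rewrite [leRHS](_ : _ = c2 / (th * L) * (L * dnorm (hess f (st_x st)) r ^+ 2)); last first.
    by field; rewrite !gt_eqF.
  apply: ler_wpM2l; last exact: le_trans m1 m2.
  exact: divr_ge0 (ltW c2_gt0) (mulr_ge0 (ltW th0) (ltW L_gt0)).
have e2 := gap _ Xx.
have mu0 z : X z -> loewner_le mu%:M (hess f z) by move=> /f_bounds[].
have sc := strong_convexity X_convex f_diff2 mu0 Xy Xx.
have Q0 : 0 <= mu / 2 * dot (st_x st - st_x st') (st_x st - st_x st').
  by rewrite mulr_ge0 ?dot_ge0 ?divr_ge0 ?ltW.
have e3 : dot r (st_x st - st_x st') =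
    dot (grad f (st_x st')) (st_x st - st_x st') + dot (- st_s st') (st_x st' - st_x st).
  by rewrite /r dotDl -[st_x st' - _]opprB dotNl dotNr opprK.
by rewrite e3 in e1; exact: descent_scalar Q0 sc e1 e2.
Qed.

Lemma residual_phase_finite (st : nat -> state (R := R) (n := n)) thbar0 eps :
  0 < thbar0 -> init_state m X thbar0 (st 0%N) ->
  omega < c * rho ^+ 2 * (1 - rho `^ p) -> 0 < eps ->
  (forall k, residual_step m X f q L2 rho omega tau c2 (st k) (st k.+1)) ->
  exists k, fw_gap X f (st_x (st k)) <= eps.
Proof.
move=> t0 init om eps0 step; apply: contrapT => /forallNP ngap.
have c0 : 0 < c by rewrite divr_gt0 ?mulr_gt0.
have Dm0 : 0 <= local_diameter X f.
  have [Xx0 _ _ _ _] := init.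
  apply: le_trans (local_diameter_ub X_compact (ltW L_gt0) _ Xx0 Xx0); first exact: hnorm_ge0.
  by move=> z /f_bounds[].
set w := omega / rho ^+ 2; have w0 : 0 < w by rewrite divr_gt0 ?exprn_gt0.
(* A residual D below d <= 1 would bound the gap by d (diameter + w) <= eps. *)
set d := Num.min 1 (eps / (local_diameter X f + w)).
have Dw : 0 < local_diameter X f + w by rewrite ltr_wpDl.
have d0 : 0 < d by rewrite lt_min ltr01 divr_gt0.
have big st' : st_inv st' -> ~ fw_gap X f (st_x st') <= eps -> d <= st_residual st'.
  move=> inv ng; rewrite leNgt; apply/negP => lt; apply: ng.
  rewrite /fw_gap; apply: (lin_gap_le X_neq0) => v Xv; apply: le_trans (st_gap_le inv Xv) _.
  have D0 := st_residual_ge0 st'; have := ltW lt; rewrite le_min => /andP[D1].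
  rewrite ler_pdivlMr//; apply: le_trans; rewrite -/w ler_wpM2l//.
  by rewrite lerD2l ler_piMr// ltW.
have inv k : st_inv (st k).
  elim: k => [|k IH]; first exact: init_state_inv t0 init.
  exact: residual_step_inv IH (st_residual_gt0 IH eps0 (ngap k)) (step k).
set dl := (c * rho ^+ 2 * (1 - rho `^ p) - omega) / B * d `^ p.
have q1 : 0 < q - 1 by move: q_gt2; lra.
have p0 : 0 < p by rewrite divr_gt0// (lt_trans _ q_gt2).
have dB : 0 < (c * rho ^+ 2 * (1 - rho `^ p) - omega) / B.
  by rewrite divr_gt0 ?B_gt0// subr_gt0.
have dl0 : 0 < dl by rewrite mulr_gt0 ?powR_gt0.
have dec k : k%:R * dl <= lyapunov (st 0%N) - lyapunov (st k).
  elim: k => [|k IH]; first by rewrite mul0r subrr.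
  have bk := big _ (inv k) (ngap k).
  have h1 := residual_step_decrease (inv k) (lt_le_trans d0 bk) (step k).
  have h2 : dl <= (c * rho ^+ 2 * (1 - rho `^ p) - omega) / B * st_residual (st k) `^ p.
    rewrite ler_pM2l// ge0_ler_powR ?nnegrE ?st_residual_ge0 ?(ltW d0)//; exact: ltW.
  rewrite -natr1 mulrDl mul1r; exact: telescope_le IH (le_trans h2 h1).
have [M hM] : exists M, forall k, M <= lyapunov (st k).
  have /compact_min : continuous f.
    by move=> y; apply: differentiable_continuous; case: f_diff2.
  move=> /(_ X X_neq0 X_compact)[y _ hy]; exists (f y) => k.
  have [Xk _ _ _ _] := inv k.
  rewrite /lyapunov ler_wpDr ?hy// mulr_ge0 ?powR_ge0//.
  exact: divr_ge0 (mulr_ge0 (ltW c0) (sqr_ge0 _)) (ltW B_gt0).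
set V := lyapunov (st 0%N) - M; have V0 : 0 <= V by rewrite subr_ge0.
(* Each step lowers the Lyapunov value by at least dl, while the total drop is at most V: this many
   steps are too many. *)
have := dec (Num.truncn (V / dl)).+1; rewrite leNgt => /negP; apply.
apply: le_lt_trans (_ : V < _); first by rewrite lerD2l lerN2.
by rewrite -ltr_pdivrMr// truncnS_gt// divr_ge0 ?ltW.
Qed.

End GlobalPhase.

(** * One step of the local phase *)

Section PowerLemmas.
Context {R : realType}.
Implicit Types a b d nu : R.

(** Otherwise both d and d - e exceed sqrt G, so d (d - e) > G. *)
Lemma le_of_sqr_le_affine (d e G : R) : 0 <= e -> 0 <= G -> d ^+ 2 <= G + e * d ->
  d <= e + Num.sqrt G.
Proof.
move=> e0 G0 h; rewrite leNgt; apply/negP => lt.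
have s0 := sqrtr_ge0 G; have sG := sqr_sqrtr G0; move: s0 sG lt.
set s := Num.sqrt G => s0 sG lt.
have h1 : s * s < d * (d - e) by apply: ltr_pM; lra.
by move: h h1; rewrite -sG; nra.
Qed.

Lemma powR_1D d nu : 0 <= d -> 0 < nu -> d `^ (1 + nu) = d * d `^ nu.
Proof.
move=> d0 n0; rewrite powRD ?powRr1//.
by rewrite gt_eqF// addr_gt0.
Qed.

Lemma powR_mul2 d (r : R) : 0 <= d -> d `^ (2 * r) = (d `^ r) ^+ 2.
Proof. by move=> d0; rewrite mulrC powRrM powR_mulrn// powR_ge0. Qed.

Lemma powR_sqrt a (r : R) : 0 <= a -> Num.sqrt a `^ r = a `^ (r / 2).
Proof. by move=> a0; rewrite -powR12_sqrt// -powRrM mulrC. Qed.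

Lemma ler_powR_l a b (r : R) : 0 <= r -> 0 <= a -> a <= b -> a `^ r <= b `^ r.
Proof.
move=> r0 a0 ab; apply: ge0_ler_powR; rewrite ?nnegrE//; exact: le_trans ab.
Qed.

End PowerLemmas.

(** * Distance and value estimates after one Newton step *)

Section LocalPhase.
Context {R : realType} {n : nat}.
Implicit Types (x y u v g : 'rV[R]_n).

Lemma model_gap_error g gs x xs u (H : 'M[R]_n) (e G : R) : psdmx H -> 0 <= e -> 0 <= G ->
  dot (qgrad g H x u) (u - xs) <= G -> 0 <= dot gs (u - xs) ->
  dot (gs - g - (xs - x) *m H) (u - xs) <= e * hnorm H (u - xs) ->
  hnorm H (u - xs) <= e + Num.sqrt G.
Proof.
move=> pH e0 G0 h1 h2 h3; apply: le_of_sqr_le_affine => //; rewrite hnorm_sqr//.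
move: h1 h3; rewrite /qgrad -(subrKA xs u (- x)) mulmxDl !dotBl !dotDl.
by lra.
Qed.

Context (X : set 'rV[R]_n) (f : 'rV[R]_n -> R) (xstar : 'rV[R]_n) (nu L2 mu L : R).
Hypotheses (X_compact : compact X) (X_convex : convex_set X).
Hypothesis f_diff2 : twice_differentiable f.
Hypothesis f_pd : forall x, X x -> pdmx (hess f x).
Hypothesis xstar_min : minimizer X f xstar.
Hypotheses (nu_gt0 : 0 < nu) (L2_gt0 : 0 < L2) (f_holder : holder2 X f L2 nu).
Hypotheses (mu_gt0 : 0 < mu) (L_gt0 : 0 < L) (f_bounds : hess_bounds X f mu L).

Let D := local_diameter X f.
Let C2 := C2_const nu L2 mu L D.

(* |xhat - x*| <= kap |x - x*|^(1+nu) for the minimizer xhat of the model at x. *)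
Definition newton_kap : R := L2 * L `^ ((1 + nu) / 2) / ((1 + nu) * Num.sqrt mu).

(** A bound for |x - xhat| / |x - xstar|: it equals 1 + [newton_kap] (D / sqrt mu)^nu, with the
    diameter absorbing the extra power nu of the distance. *)
Definition newton_E : R := 1 + L2 * L `^ ((1 + nu) / 2) * D `^ nu
  / ((1 + nu) * mu `^ ((1 + nu) / 2)).

Lemma C2E : C2 = newton_kap + Num.sqrt (2 / mu) * newton_E `^ (1 + nu).
Proof. by []. Qed.

Lemma nu1_gt0 : 0 < 1 + nu.
Proof. by rewrite addr_gt0. Qed.

Lemma newton_kap_ge0 : 0 <= newton_kap.
Proof.
rewrite divr_ge0// mulr_ge0 ?powR_ge0 ?sqrtr_ge0 ?(ltW L2_gt0)//.
exact: ltW nu1_gt0.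
Qed.

Lemma newton_E_ge1 : 1 <= newton_E.
Proof.
rewrite lerDl; apply: divr_ge0; apply: mulr_ge0; rewrite ?powR_ge0//.
  by apply: mulr_ge0; [exact: ltW|exact: powR_ge0].
exact: ltW nu1_gt0.
Qed.

Lemma C2_gt0 : 0 < C2.
Proof.
rewrite C2E ltr_wpDl ?newton_kap_ge0// mulr_gt0 ?sqrtr_gt0 ?divr_gt0// powR_gt0//.
exact: lt_le_trans newton_E_ge1.
Qed.

Let smu0 : 0 < Num.sqrt mu. Proof. by rewrite sqrtr_gt0. Qed.

Lemma enorm_hnorm_le x y : X x -> enorm y <= hnorm (hess f x) y / Num.sqrt mu.
Proof.
move=> Xx; rewrite ler_pdivlMr// mulrC.
have [lmu _] : loewner_le mu%:M (hess f x) /\ _ := f_bounds Xx.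
exact: enorm_le_hnorm (ltW mu_gt0) lmu (pd_psdmx (f_pd Xx)).
Qed.

Lemma hnorm_enorm_le x y : X x -> hnorm (hess f x) y <= Num.sqrt L * enorm y.
Proof.
move=> Xx; have [_ lL] : _ /\ loewner_le (hess f x) L%:M := f_bounds Xx.
exact: hnorm_le_enorm (ltW L_gt0) lL.
Qed.

Lemma enorm_diam x y : X x -> X y -> enorm (x - y) <= D / Num.sqrt mu.
Proof.
move=> Xx Xy; apply: le_trans (enorm_hnorm_le _ Xx) _.
rewrite ler_pM2r ?invr_gt0//.
by apply: (local_diameter_ub X_compact (ltW L_gt0)) => // z /f_bounds[].
Qed.

Let e x := L2 / (1 + nu) * hnorm (hess f x) (xstar - x) `^ (1 + nu).

(** Stated for any gap level G so that it serves the exact model minimizer, with G = 0, as well as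
    the inexact point returned by the inner run. *)
Lemma model_gap_bound x u (G : R) : X x -> X u -> 0 <= G ->
  (forall v, X v -> dot (qgrad (grad f x) (hess f x) x u) (u - v) <= G) ->
  hnorm (hess f x) (u - xstar) <= e x + Num.sqrt G.
Proof.
move=> Xx Xu G0 gap; have [Xs _] := xstar_min.
apply: (model_gap_error (pd_psdmx (f_pd Xx)) _ G0 (gap _ Xs)).
- by rewrite mulr_ge0 ?powR_ge0// divr_ge0 ?(ltW L2_gt0) ?(ltW nu1_gt0).
- by apply: first_order_optimality X_convex _ xstar_min Xu; case: f_diff2.
- exact: (holder_taylor X_convex f_diff2 f_pd nu_gt0 f_holder _ Xx Xs).
Qed.

Lemma e_le x : X x -> e x / Num.sqrt mu <= newton_kap * enorm (x - xstar) `^ (1 + nu).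
Proof.
move=> Xx.
have h : hnorm (hess f x) (xstar - x) `^ (1 + nu) <=
    L `^ ((1 + nu) / 2) * enorm (x - xstar) `^ (1 + nu).
  rewrite -(powR_sqrt _ (ltW L_gt0)) -powRM ?sqrtr_ge0 ?enorm_ge0//.
  apply: ler_powR_l; [exact: ltW nu1_gt0|exact: hnorm_ge0|].
  by rewrite enormB; exact: hnorm_enorm_le.
have c0 : 0 <= L2 / (1 + nu) / Num.sqrt mu.
  by rewrite !divr_ge0 ?(ltW L2_gt0) ?(ltW nu1_gt0) ?(ltW smu0).
have := ler_wpM2l c0 h; rewrite /e /newton_kap.
generalize (hnorm (hess f x) (xstar - x) `^ (1 + nu)) (enorm (x - xstar) `^ (1 + nu)).
generalize (L `^ ((1 + nu) / 2)) => l a b le.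
rewrite mulrAC (le_trans le)// le_eqVlt; apply/orP; left; apply/eqP; field.
by rewrite !gt_eqF// nu1_gt0.
Qed.

Lemma model_minimizer_dist x xhat : X x -> X xhat ->
  (forall v, X v -> 0 <= dot (qgrad (grad f x) (hess f x) x xhat) (v - xhat)) ->
  enorm (x - xhat) <= newton_E * enorm (x - xstar).
Proof.
move=> Xx Xh opt; have [Xs _] := xstar_min.
have gap v : X v -> dot (qgrad (grad f x) (hess f x) x xhat) (xhat - v) <= 0.
  by move=> Xv; rewrite -opprB dotNr oppr_le0 opt.
have := model_gap_bound Xx Xh (lexx 0) gap; rewrite sqrtr0 addr0 => h.
apply: le_trans (enorm_tri x xstar xhat) _.
have h2 : enorm (xstar - xhat) <= newton_kap * enorm (x - xstar) `^ (1 + nu).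
  rewrite enormB; apply: le_trans (enorm_hnorm_le _ Xx) _.
  apply: le_trans (e_le Xx); rewrite ler_pM2r ?invr_gt0//.
have d0 := enorm_ge0 (x - xstar).
apply: le_trans (lerD (lexx _) h2) _; rewrite powR_1D//.
rewrite /newton_E mulrDl mul1r lerD2l mulrCA mulrC ler_wpM2r//.
apply: (@le_trans _ _ (newton_kap * (D `^ nu / mu `^ (nu / 2)))).
  rewrite ler_wpM2l ?newton_kap_ge0//.
  rewrite ler_pdivlMr ?powR_gt0// -powR_sqrt ?(ltW mu_gt0)// -powRM ?(ltW smu0)//.
  apply: ler_powR_l; [exact: ltW|by rewrite mulr_ge0 ?(ltW smu0)|].
  by rewrite -ler_pdivlMr// enorm_diam.
rewrite le_eqVlt; apply/orP; left; apply/eqP; rewrite /newton_kap.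
have -> : mu `^ ((1 + nu) / 2) = Num.sqrt mu * mu `^ (nu / 2).
  rewrite -!powR_sqrt ?(ltW mu_gt0)// powR_1D// ltW//.
field; rewrite !gt_eqF// ?nu1_gt0// powR_gt0//.
Qed.

Definition newton_point x u :=
  [/\ X x, X u, Psi1 f x u <= f x
    & lin_gap X (qgrad (grad f x) (hess f x) x u) u
        <= ((f x - Psi1 f x u) / enorm (grad f x)) `^ (2 * (1 + nu))].

(** The model decrease at u is at most that at xhat, hence at most <grad f(x), x - xhat> <= |grad
    f(x)| |x - xhat|. The exponent 2 (1 + nu) makes the bound a square, ready for the square root in
    [model_gap_bound]. *)
Lemma newton_point_gap x u v : newton_point x u -> X v ->
  dot (qgrad (grad f x) (hess f x) x u) (u - v) <=
  ((newton_E * enorm (x - xstar)) `^ (1 + nu)) ^+ 2.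
Proof.
move=> [Xx Xu le stop] Xv; have pH := pd_psdmx (f_pd Xx).
apply: le_trans (lin_gap_ub _ _ X_compact Xv) _; apply: le_trans stop _.
have [xhat Xh [hmin opt]] := Psi1_minimizer X_convex X_compact (ex_intro _ x Xx) pH.
have Ed0 : 0 <= newton_E * enorm (x - xstar).
  by rewrite mulr_ge0 ?enorm_ge0// (le_trans ler01 newton_E_ge1).
rewrite -powR_mul2//; apply: ler_powR_l.
- by rewrite mulr_ge0// ltW// nu1_gt0.
- by rewrite divr_ge0 ?enorm_ge0 ?subr_ge0.
apply: le_trans (model_minimizer_dist Xx Xh opt).
(* A zero gradient makes the quotient 0, since the inverse of 0 is 0. *)
have [->|gn] := eqVneq (enorm (grad f x)) 0; first by rewrite invr0 mulr0 enorm_ge0.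
rewrite ler_pdivrMr ?lt_def ?gn ?enorm_ge0//.
have : dot (grad f x) (x - xhat) <= enorm (x - xhat) * enorm (grad f x).
  by rewrite mulrC cauchy_schwarz.
apply: le_trans; have := hmin _ Xu; rewrite [X in X <= _ -> _]Psi1E//.
have -> : dot (grad f x) (x - xhat) = - dot (grad f x) (xhat - x).
  by rewrite -dotNr opprB.
have := proj2 pH (xhat - x).
generalize (dot ((xhat - x) *m hess f x) (xhat - x)) (dot (grad f x) (xhat - x)).
by generalize (Psi1 f x u) (f x) => a b c d' c0; lra.
Qed.

Lemma newton_point_enorm x u : newton_point x u ->
  enorm (u - xstar) <= C2 * enorm (x - xstar) `^ (1 + nu).
Proof.
move=> np; have [Xx Xu _ _] := np.
have Ed0 : 0 <= newton_E * enorm (x - xstar).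
  by rewrite mulr_ge0 ?enorm_ge0// (le_trans ler01 newton_E_ge1).
have := model_gap_bound Xx Xu (sqr_ge0 _) (fun v => @newton_point_gap x u v np).
rewrite sqrtr_sqr ger0_norm ?powR_ge0// powRM ?enorm_ge0 ?(le_trans ler01 newton_E_ge1)// => h.
apply: le_trans (enorm_hnorm_le _ Xx) _.
have : hnorm (hess f x) (u - xstar) / Num.sqrt mu <=
    (e x + newton_E `^ (1 + nu) * enorm (x - xstar) `^ (1 + nu)) / Num.sqrt mu.
  by rewrite ler_pM2r ?invr_gt0.
move=> /le_trans; apply; rewrite mulrDl C2E mulrDl; apply: lerD; first exact: e_le.
rewrite [leLHS]mulrC [leLHS]mulrA; do 2?[apply: ler_wpM2r; first exact: powR_ge0].
(* The estimate yields 1 / sqrt mu; the constant [C2] leaves room with sqrt (2 / mu). *)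
rewrite -sqrtrV ?(ltW mu_gt0)//; apply: ler_wsqrtr.
by rewrite ler_peMl ?invr_ge0 ?(ltW mu_gt0)// ler1n.
Qed.

(** The first term comes from the model gap; the second from the Taylor remainder, a product of |u -
    x|^(1+nu) and |u - xstar|. *)
Definition newton_F : R :=
  newton_E `^ (1 + nu) ^+ 2 + L2 / (1 + nu) *
  (Num.sqrt L * (C2 * (D / Num.sqrt mu) `^ nu + 1)) `^ (1 + nu) * (Num.sqrt L * C2).

Lemma newton_F_gt0 : 0 < newton_F.
Proof.
have Ep : 0 < newton_E by exact: lt_le_trans newton_E_ge1.
rewrite ltr_wpDr ?exprn_gt0 ?powR_gt0//.
apply: mulr_ge0; last exact: mulr_ge0 (sqrtr_ge0 _) (ltW C2_gt0).
apply: mulr_ge0; last exact: powR_ge0.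
by rewrite divr_ge0 ?(ltW L2_gt0) ?(ltW nu1_gt0).
Qed.

Lemma newton_point_value x u : newton_point x u ->
  f u - f xstar <= newton_F * (enorm (x - xstar) `^ (1 + nu)) ^+ 2.
Proof.
move=> np; have [Xx Xu _ _] := np; have [Xs _] := xstar_min.
have mu0 z : X z -> loewner_le mu%:M (hess f z) by move=> /f_bounds[].
have cvx : f u - f xstar <= dot (grad f u) (u - xstar).
  rewrite lerBlDl -lerBlDr -dotNr opprB.
  apply: le_trans (strong_convexity X_convex f_diff2 mu0 Xu Xs).
  by rewrite lerDl mulr_ge0 ?dot_ge0// divr_ge0// ltW.
have taylor := holder_taylor X_convex f_diff2 f_pd nu_gt0 f_holder (u - xstar) Xx Xu.
have gap := newton_point_gap np Xs.
have split_grad : dot (grad f u) (u - xstar) =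
    dot (qgrad (grad f x) (hess f x) x u) (u - xstar) +
    dot (grad f u - grad f x - (u - x) *m hess f x) (u - xstar).
  rewrite -dotDl /qgrad; congr (dot _ _).
  by rewrite -[grad f u - _ - _]addrA -opprD [RHS]addrC subrK.
have d0 := enorm_ge0 (x - xstar).
have step1 : enorm (u - xstar) <= C2 * enorm (x - xstar) `^ (1 + nu).
  exact: newton_point_enorm np.
(* Through xstar, u is within a multiple of |x - xstar| of x, one power nu of the distance being
   bounded by the diameter. *)
have step2 : hnorm (hess f x) (u - x) <=
    Num.sqrt L * (C2 * (D / Num.sqrt mu) `^ nu + 1) * enorm (x - xstar).
  apply: le_trans (hnorm_enorm_le _ Xx) _; rewrite -mulrA ler_wpM2l ?sqrtr_ge0//.
  apply: le_trans (enorm_tri u xstar x) _; rewrite mulrDl mul1r.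
  rewrite (enormB xstar x) lerD2r; apply: le_trans step1 _.
  rewrite powR_1D// mulrCA mulrC ler_wpM2r// ler_wpM2l ?(ltW C2_gt0)//.
  by apply: ler_powR_l; [exact: ltW|exact: d0|exact: enorm_diam].
have step3 : hnorm (hess f x) (u - xstar) <= Num.sqrt L * C2 * enorm (x - xstar) `^ (1 + nu).
  apply: le_trans (hnorm_enorm_le _ Xx) _.
  by rewrite -mulrA ler_wpM2l ?sqrtr_ge0.
set K := Num.sqrt L * (C2 * (D / Num.sqrt mu) `^ nu + 1) in step2 *.
have K0 : 0 <= K.
  by rewrite mulr_ge0 ?sqrtr_ge0// addr_ge0// mulr_ge0 ?powR_ge0 ?(ltW C2_gt0).
have step4 : hnorm (hess f x) (u - x) `^ (1 + nu) <=
    K `^ (1 + nu) * enorm (x - xstar) `^ (1 + nu).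
  rewrite -powRM//; apply: ler_powR_l; [exact: ltW nu1_gt0|exact: hnorm_ge0|exact: step2].
apply: le_trans cvx _; rewrite split_grad; apply: le_trans (lerD gap taylor) _.
rewrite powRM//; last exact: le_trans newton_E_ge1.
rewrite exprMn /newton_F mulrDl lerD2l -/K.
have l0 : 0 <= L2 / (1 + nu) by rewrite divr_ge0 ?(ltW L2_gt0) ?(ltW nu1_gt0).
apply: le_trans (ler_pM _ _ (ler_wpM2l l0 step4) step3) _.
- by rewrite mulr_ge0 ?powR_ge0.
- exact: hnorm_ge0.
rewrite le_eqVlt; apply/orP; left; apply/eqP.
generalize (L2 / (1 + nu)) (K `^ (1 + nu)) (enorm (x - xstar) `^ (1 + nu)).
by move=> *; ring.
Qed.

End LocalPhase.

(** * Superlinear sequences and the gap *)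

Section SuperlinearSequences.
Context {R : realType}.
Implicit Types (d : nat -> R) (C nu : R) (N k j : nat).

(** While d_k <= d_N the factor C d_k^nu is at most 1/2, so the next term is at most d_k / 2 and the
    condition persists. *)
Lemma superlinear_half d C nu N : 0 < nu -> 0 < C -> (forall k, 0 <= d k) ->
  (forall k, (N <= k)%N -> d k.+1 <= C * d k `^ (1 + nu)) -> C * d N `^ nu <= 2^-1 ->
  forall j, d (N + j)%N <= d N /\ C * d (N + j)%N `^ (1 + nu) <= 2^-1 * d (N + j)%N.
Proof.
move=> nu0 C0 d0 rec start.
have half k : d k <= d N -> C * d k `^ (1 + nu) <= 2^-1 * d k.
  move=> le; rewrite powR_1D// mulrCA mulrC ler_wpM2r//.
  apply: le_trans start; rewrite ler_pM2l//.
  by apply: ler_powR_l => //; exact: ltW.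
elim=> [|j [IH _]]; first by rewrite addn0; split=> //; exact: half.
suff le : d (N + j.+1)%N <= d N by split=> //; exact: half.
rewrite addnS; apply: le_trans (rec _ (leq_addr _ _)) _.
apply: le_trans (half _ IH) _; apply: le_trans IH.
by rewrite ler_piMl// invf_le1// ler1n.
Qed.

Lemma superlinear_cvg d C nu N : 0 < nu -> 0 < C -> (forall k, 0 <= d k) ->
  (forall k, (N <= k)%N -> d k.+1 <= C * d k `^ (1 + nu)) -> C * d N `^ nu <= 2^-1 ->
  d k @[k --> \oo] --> 0.
Proof.
move=> nu0 C0 d0 rec start; have half := superlinear_half nu0 C0 d0 rec start.
have geo j : d (N + j)%N <= 2^-1 ^+ j * d N.
  elim: j => [|j IH]; first by rewrite addn0 mul1r.
  have [_ h] := half j; rewrite addnS exprS -mulrA.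
  apply: le_trans (rec _ (leq_addr _ _)) _; apply: le_trans h _.
  by rewrite ler_pM2l.
rewrite -(cvg_shiftn N).
apply: (@squeeze_cvgr _ _ _ _ (fun=> 0) (fun j => d N * 2^-1 ^+ j)).
- by near=> j; rewrite d0 /= addnC mulrC geo.
- exact: cvg_cst.
- apply: (@cvg_geometric _ (d N) 2^-1).
  by rewrite ger0_norm ?invr_ge0// invf_lt1// ltr1n.
Unshelve. all: by end_near. Qed.

Lemma cvg_square_bound d (u : nat -> R) (F : R) N : d k @[k --> \oo] --> 0 ->
  (forall k, 0 <= u k) -> (forall k, (N <= k)%N -> u k.+1 <= F * d k ^+ 2) ->
  u k @[k --> \oo] --> 0.
Proof.
move=> cd u0 le; rewrite -cvg_shiftS.
apply: (@squeeze_cvgr _ _ _ _ (fun=> 0) (fun k => F * (d k * d k))).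
- near=> k; rewrite u0 /= -expr2 le//.
  by near: k; exact: nbhs_infty_ge.
- exact: cvg_cst.
- have : F * (d k * d k) @[k --> \oo] --> F * (0 * 0).
    by apply: cvgM; [exact: cvg_cst|exact: cvgM].
  by rewrite !mulr0.
Unshelve. all: by end_near. Qed.

Lemma Q_order_of_rate d C nu N : 0 < nu -> 0 < C -> (forall k, 0 <= d k) ->
  (forall k, (N <= k)%N -> d k.+1 <= C * d k `^ (1 + nu)) -> d k @[k --> \oo] --> 0 ->
  Q_order_at_least (1 + nu) d.
Proof.
move=> nu0 C0 d0 rec cd; split=> //; first by rewrite ltrDl.
exists C => //; near=> k; apply: rec; near: k; exact: nbhs_infty_ge.
Unshelve. all: by end_near. Qed.

End SuperlinearSequences.

(** * Distance to the minimizer, bounded by values and by the gap *)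

Section Gap.
Context {R : realType} {n : nat} (X : set 'rV[R]_n) (f : 'rV[R]_n -> R) (xstar : 'rV[R]_n).
Context (mu : R).
Hypotheses (X_compact : compact X) (X_convex : convex_set X).
Hypothesis f_diff2 : twice_differentiable f.
Hypothesis xstar_min : minimizer X f xstar.
Hypothesis (f_mu : forall z, X z -> loewner_le mu%:M (hess f z)).

Lemma dist_le_value x : X x -> mu / 2 * enorm (x - xstar) ^+ 2 <= f x - f xstar.
Proof.
move=> Xx; have [Xs _] := xstar_min.
rewrite enorm_sqr lerBrDl; apply: le_trans (strong_convexity X_convex f_diff2 f_mu Xs Xx).
rewrite lerD2r lerDl; apply: first_order_optimality X_convex _ xstar_min Xx.
by case: f_diff2.
Qed.

(** Strong convexity from x towards xstar, together with the minimality of xstar, leaves <grad f(x),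
    x - xstar> >= mu / 2 |x - xstar|^2. *)
Lemma dist_le_gap x : X x -> mu / 2 * enorm (x - xstar) ^+ 2 <= fw_gap X f x.
Proof.
move=> Xx; have [Xs min] := xstar_min.
apply: le_trans (lin_gap_ub (grad f x) x X_compact Xs).
have := strong_convexity X_convex f_diff2 f_mu Xx Xs; have := min _ Xx.
rewrite enormB enorm_sqr => h1 /le_trans/(_ h1).
rewrite -addrA gerDl -(opprB x xstar) dotNr addrC subr_le0.
by [].
Qed.

Lemma gap0_minimizer x : 0 < mu -> X x -> fw_gap X f x = 0 -> x = xstar.
Proof.
move=> mu0 Xx g0; have := dist_le_gap Xx; rewrite g0.
rewrite pmulr_rle0 ?divr_gt0// => le.
have : enorm (x - xstar) ^+ 2 == 0 by rewrite eq_le le sqr_ge0.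
by rewrite sqrf_eq0 enorm_eq0 subr_eq0 => /eqP.
Qed.

End Gap.

(** * From the method to the local estimates, and the conclusion *)

Lemma newton_step_spec (R : realType) (n : nat) (X : set 'rV[R]_n) (f : 'rV[R]_n -> R)
    (nu : R) (m : inner_kind) (st st' : state) :
  convex_set X -> (forall x, X x -> pdmx (hess f x)) -> X (st_x st) ->
  (m = AFW -> vertex_rep X (st_x st) (st_lam st)) ->
  fw_gap X f (st_x st) <> 0 -> newton_step m X f (2 * (1 + nu)) st st' ->
  newton_point X f nu (st_x st) (st_x st') /\
  (m = AFW -> vertex_rep X (st_x st') (st_lam st')).
Proof.
move=> cX pd Xx rep g0; rewrite /newton_step; case: eqP => // _.
have pH := pd_psdmx (pd _ Xx).
move=> /(inner_returns_spec cX pH Xx rep)[Xu rep' q [v _ stopv]].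
split=> //; split=> //.
  by rewrite Psi1E// -addrA gerDl.
exact: (eq_ind _ (fun g => lin_gap X g (st_x st') <= _) stopv _ (grad_Psi1 _ pH)).
Qed.

(** The gap threshold is chosen to mean d <= (2C)^(-1/nu), that is C d^nu <= 1/2. *)
Lemma start_half (R : realType) (mu C nu d : R) : 0 < mu -> 0 < C -> 0 < nu -> 0 <= d ->
  mu / 2 * d ^+ 2 <= mu / 2 * (2 * C) `^ (- 2 / nu) -> C * d `^ nu <= 2^-1.
Proof.
move=> mu0 C0 nu0 d0; rewrite ler_pM2l ?divr_gt0//.
have c0 : 0 < 2 * C by rewrite mulr_gt0.
have -> : (2 * C) `^ (- 2 / nu) = ((2 * C) `^ (- nu^-1)) ^+ 2.
  by rewrite -powR_mul2 ?(ltW c0)// mulrN -mulNr.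
rewrite ler_pXn2r ?nnegrE ?powR_ge0// => le.
have := ler_powR_l (ltW nu0) d0 le.
rewrite -powRrM mulNr mulVf ?gt_eqF// powR_inv1 ?(ltW c0)// => h.
rewrite -(ler_pM2l C0) in h; apply: le_trans h _.
by rewrite invfM mulrCA divff ?gt_eqF// mulr1.
Qed.

Theorem theorem3p8 (R : realType) (n : nat) (X : set 'rV[R]_n)
    (f : 'rV[R]_n -> R) (xstar : 'rV[R]_n) (nu q L2 : R)
    (X_neq0 : X !=set0) (X_compact : compact X) (X_convex : convex_set X)
    (f_convex : convex_function [set: 'rV[R]_n] f)
    (f_diff2 : twice_differentiable f)
    (f_pd : forall x, X x -> pdmx (hess f x))
    (xstar_min : minimizer X f xstar)
    (nu_gt0 : 0 < nu) (nu_le1 : nu <= 1) (q_def : q = 2 + nu)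
    (L2_gt0 : 0 < L2) (f_holder : holder2 X f L2 nu) :
  (exists mu L : R, [/\ 0 < mu, 0 < L & hess_bounds X f mu L]) /\
  forall (mu L rho omega thbar0 tau c2 C2 : R) (m : inner_kind)
      (K2 : option nat) (x : nat -> 'rV[R]_n),
    0 < mu -> 0 < L -> hess_bounds X f mu L ->
    0 < rho -> rho < 1 -> c2 = 1 / 2 ->
    0 < omega ->
    omega < c2 * mu / L * rho ^+ 2 * (1 - rho `^ (q / (q - 1))) ->
    0 < thbar0 -> 1 < tau ->
    C2 = C2_const nu L2 mu L (local_diameter X f) ->
    is_first (fun k => fw_gap X f (x k) <= mu / 2 * (2 * C2) `^ (- 2 / nu)) K2 ->
    switched_method m X f q L2 rho omega thbar0 tau c2 K2 (2 * (1 + nu)) x ->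
  exists2 N : nat, K2 = Some N &
    (exists k, x k = xstar) \/
    [/\ forall k, (N <= k)%N ->
          enorm (x k.+1 - xstar) <= C2 * enorm (x k - xstar) `^ (1 + nu),
        exists2 Ct : R, 0 < Ct & forall k, (N <= k)%N ->
          f (x k.+1) - f xstar <= Ct * (f (x k) - f xstar) `^ (1 + nu),
        Q_order_at_least (1 + nu) (fun k => enorm (x k - xstar)),
        Q_order_at_least (1 + nu) (fun k => f (x k) - f xstar)
      & nu = 1 -> Q_quadratic (fun k => enorm (x k - xstar)) /\
                  Q_quadratic (fun k => f (x k) - f xstar)].
Proof.
split; first exact: hess_bounds_exist f_pd nu_gt0 L2_gt0 f_holder X_compact.
move=> mu L rho omega thbar0 tau c2 C2 m K2 x mu0 L0 bnd rho0 rho1 c2E om0 om1 th0 tau1 C2E.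
move=> first [st [init step xE]].
have c20 : 0 < c2 by rewrite c2E divr_gt0.
have q2 : 2 < q by rewrite q_def ltrDl.
have C20 : 0 < C2 by rewrite C2E; exact: C2_gt0.
set eps := mu / 2 * (2 * C2) `^ (- 2 / nu) in first.
have eps0 : 0 < eps by rewrite mulr_gt0 ?divr_gt0// powR_gt0// mulr_gt0.
have inv0 : st_inv X m omega (st 0%N) := init_state_inv omega th0 init.
(* With [None] every iteration is a residual step and the gap never meets the threshold, which
   [residual_phase_finite] excludes. *)
have [N K2E] : exists N, K2 = Some N.
  case: K2 first step => [N|] first step; first by exists N.
  have [k gk] := residual_phase_finite X_neq0 X_compact X_convex f_diff2 f_pd mu0 L0 bnd
    rho0 rho1 om0 tau1 c20 q2 L2_gt0 th0 init om1 eps0 step.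
  by case: (first k); rewrite xE.
exists N => //; rewrite {}K2E /= in first step.
have [Pn nP] := first.
(* If xstar is never reached, the gap never vanishes after the switch, so every later step is a
   genuine inner run rather than the constant continuation. *)
have [[k xk]|nx] := pselect (exists k, x k = xstar); first by left; exists k.
right.
have fmu z : X z -> loewner_le mu%:M (hess f z) by move=> /bnd[].
have invN k : (k <= N)%N -> st_inv X m omega (st k).
  elim: k => [//|k IH] kN; have invk := IH (ltnW kN).
  have ng : ~ fw_gap X f (st_x (st k)) <= eps by rewrite -xE; exact: nP.
  have r0 := st_residual_gt0 X_neq0 X_compact f_pd L0 bnd rho0 om0 invk eps0 ng.
  have sk : residual_step m X f q L2 rho omega tau c2 (st k) (st k.+1).
    by have := step k; rewrite kN.
  exact: (residual_step_inv X_convex f_pd om0 tau1 L2_gt0 invk r0 sk).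
have rep j : X (st_x (st (N + j)%N)) /\
    (m = AFW -> vertex_rep X (st_x (st (N + j)%N)) (st_lam (st (N + j)%N))).
  elim: j => [|j [Xj repj]].
    by rewrite addn0; have [? ? _ _ _] := invN N (leqnn N).
  have sj : newton_step m X f (2 * (1 + nu)) (st (N + j)%N) (st (N + j.+1)%N).
    by have := step (N + j)%N; rewrite ltnNge leq_addr addnS.
  have g0 : fw_gap X f (st_x (st (N + j)%N)) <> 0.
    move=> /(gap0_minimizer X_compact X_convex f_diff2 xstar_min fmu mu0 Xj) e.
    by apply: nx; exists (N + j)%N; rewrite xE.
  by have [[_ Xu _ _] rj] := newton_step_spec X_convex f_pd Xj repj g0 sj.
have np k : (N <= k)%N -> newton_point X f nu (x k) (x k.+1).
  move=> Nk; rewrite !xE; have := rep (k - N)%N; rewrite subnKC// => -[Xk repk].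
  have sk : newton_step m X f (2 * (1 + nu)) (st k) (st k.+1).
    by have := step k; rewrite ltnNge Nk.
  have g0 : fw_gap X f (st_x (st k)) <> 0.
    move=> /(gap0_minimizer X_compact X_convex f_diff2 xstar_min fmu mu0 Xk) e.
    by apply: nx; exists k; rewrite xE.
  by have [] := newton_step_spec X_convex f_pd Xk repk g0 sk.
pose d k := enorm (x k - xstar).
have rate k : (N <= k)%N -> d k.+1 <= C2 * d k `^ (1 + nu).
  move=> Nk; rewrite /d C2E.
  exact: (newton_point_enorm X_compact X_convex f_diff2 f_pd xstar_min nu_gt0 L2_gt0
    f_holder mu0 L0 bnd (np k Nk)).
set F := newton_F X f nu L2 mu L.
have F0 : 0 < F by exact: newton_F_gt0.
have value k : (N <= k)%N -> f (x k.+1) - f xstar <= F * (d k `^ (1 + nu)) ^+ 2.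
  move=> Nk; exact: (newton_point_value X_compact X_convex f_diff2 f_pd xstar_min nu_gt0
    L2_gt0 f_holder mu0 L0 bnd (np k Nk)).
have XN : X (x N) by have [] := np N (leqnn N).
have start : C2 * d N `^ nu <= 2^-1.
  apply: (start_half mu0 C20 nu_gt0 (enorm_ge0 _)).
  apply: le_trans (dist_le_gap X_compact X_convex f_diff2 xstar_min fmu XN) Pn.
have d0 k : 0 <= d k by exact: enorm_ge0.
have dcvg := superlinear_cvg nu_gt0 C20 d0 rate start.
have Xall k : X (x k).
  have [kN|/np[]//] := ltnP k N.
  by rewrite xE; have [? _ _ _ _] := invN k (ltnW kN).
have v0 k : 0 <= f (x k) - f xstar.
  by rewrite subr_ge0; case: xstar_min => _; apply.
(* The factor 2 / mu converts |x_k - xstar|^2 into the value excess, through [dist_le_value]. *)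
have Ct0 : 0 < F * (2 / mu) `^ (1 + nu) by rewrite mulr_gt0// powR_gt0// divr_gt0.
have vrate k : (N <= k)%N -> f (x k.+1) - f xstar <=
    F * (2 / mu) `^ (1 + nu) * (f (x k) - f xstar) `^ (1 + nu).
  move=> Nk; apply: le_trans (value k Nk) _; rewrite -mulrA ler_pM2l//.
  have -> : (d k `^ (1 + nu)) ^+ 2 = (d k ^+ 2) `^ (1 + nu).
    by rewrite -powR_mul2// powRrM powR_mulrn.
  rewrite -powRM ?v0// ?divr_ge0 ?(ltW mu0)//.
  apply: ler_powR_l; [by rewrite addr_ge0// ltW|exact: sqr_ge0|].
  have m2 : 0 < mu / 2 by rewrite divr_gt0.
  rewrite -(ler_pM2l m2) [leRHS]mulrA (_ : mu / 2 * (2 / mu) = 1) ?mul1r.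
    exact: (dist_le_value X_convex f_diff2 xstar_min fmu (Xall k)).
  by field; rewrite gt_eqF.
have vcvg : f (x k) - f xstar @[k --> \oo] --> 0.
  (* After the switch d_k^(1+nu) <= d_k / (2 C2), so the value bound is quadratic in d_k with this
     constant. *)
  apply: (@cvg_square_bound _ d _ (F * (2 * C2) ^- 2) N) => // k Nk.
  apply: le_trans (value k Nk) _; rewrite -mulrA ler_pM2l//.
  have [_] := superlinear_half nu_gt0 C20 d0 rate start (k - N).
  rewrite subnKC// => h; have c0 : 0 < 2 * C2 by rewrite mulr_gt0.
  rewrite -exprVn -exprMn lerXn2r ?nnegrE ?powR_ge0 ?mulr_ge0 ?invr_ge0 ?(ltW c0)//.
  by rewrite ler_pdivlMl// -mulrA -ler_pdivlMl.
have Qd := Q_order_of_rate nu_gt0 C20 d0 rate dcvg.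
have Qv := Q_order_of_rate nu_gt0 Ct0 v0 vrate vcvg.
split=> //; first by exists (F * (2 / mu) `^ (1 + nu)).
move=> nu1; rewrite /Q_quadratic (_ : 2 = 1 + nu) ?nu1//.
by rewrite nu1 in Qd Qv.
Qed.
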